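(* The approximation ratio of the \textsc{Ranking} algorithm on general graphs is at least $0.560$. That is, for every finite simple undirected graph $G=(V,E)$ with at least one edge, $$\frac{\mathbb{E}_{\vec x}\big[|\textsc{R}(\vec x)|\big]}{|M^*(G)|}\ \ge\ 0.560,$$ where $\textsc{R}(\vec x)$ is the matching output by \textsc{Ranking} with rank vector $\vec x$ and $M^*(G)$ is a maximum matching of $G$.
   Context: \textsc{Ranking} on a graph $G=(V,E)$: independently for each $v\in V$ sample a rank $x_v$ uniformly from $[0,1]$, giving the rank vector $\vec x$. Process the vertices in increasing order of $x_v$; when $v$ is processed, if $v$ is still unmatched and has an unmatched neighbor, match $v$ to its unmatched neighbor $u$ with the smallest rank $x_u$. The approximation ratio is the infimum over all graphs of the expected size of the output matching divided by the size of a maximum matching. *)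

(* Defs.v *)
From HB Require Import structures.
From mathcomp Require Import all_boot all_order all_algebra.
From mathcomp Require Import all_classical all_reals all_analysis.

Set Implicit Arguments.
Unset Strict Implicit.
Unset Printing Implicit Defensive.

Import Order.TTheory GRing.Theory Num.Theory.
Import numFieldNormedType.Exports.

Local Open Scope ring_scope.

Section Graph.
Variable V : finType.
Implicit Types (e : rel V) (M : {set {set V}}).

Definition simple_graph e : Prop := symmetric e /\ irreflexive e.

Definition is_edge e (A : {set V}) : bool :=
  [exists u, exists v, e u v && (A == [set u; v]%SET)].

Definition is_matching e M : bool :=
  [forall A in M, is_edge e A] && finset.trivIset M.

(* |M*(G)| *)
Definition matching_number e : nat :=
  (\max_(M : {set {set V}} | is_matching e M) #|M|)%N.

Variables (R : realType) (e : rel V) (x : V -> R).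

Definition free_nbr M (v u : V) : bool := e v u && (u \notin finset.cover M).

(* The unmatched neighbor of [v] of smallest rank.  Ties, here and in
   [ranking], are broken by the enumeration of [V]; they have probability 0. *)
Definition best_nbr M (v : V) : option V :=
  [pick u | free_nbr M v u & [forall w, free_nbr M v w ==> (x u <= x w)]].

Definition ranking_step M (v : V) : {set {set V}} :=
  if v \in finset.cover M then M
  else if best_nbr M v is Some u then ([set v; u] |: M)%SET else M.

Definition ranking : {set {set V}} :=
  foldl ranking_step finset.set0 (sort (fun u v => x u <= x v) (enum V)).

End Graph.

Section UniformRanks.
Variable R : realType.

Local Notation mR := (measurableTypeR R).

Definition unif01 : probability mR R := uniform_prob (@ltr01 R).

Definition cons_pair n (p : mR * n.-tuple mR) : n.+1.-tuple mR :=
  [tuple of p.1 :: p.2].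

Lemma measurable_cons_pair n : measurable_fun setT (@cons_pair n).
Proof. exact: measurable_cons. Qed.

HB.instance Definition _ n :=
  isMeasurableFun.Build _ _ _ _ (@cons_pair n) (@measurable_cons_pair n).

(* The law of [n] independent uniform ranks, i.e. the [n]-fold product of
   [unif01]; see [unif_ranks_box]. *)
Fixpoint unif_ranks n : probability (n.-tuple mR) R :=
  if n is m.+1 then distribution (unif01 \x unif_ranks m)%E (@cons_pair m)
  else dirac [tuple].

Lemma unif_ranks_box n (A : 'I_n -> set mR) :
  (forall i, measurable (A i)) ->
  unif_ranks n [set t | forall i, A i (tnth t i)]%classic =
  (\prod_(i < n) unif01 (A i))%E.
Proof.
elim: n A => [|n IHn] A mA.
  rewrite big_ord0 /= diracE mem_set//= => -[]//.
rewrite big_ord_recl/= /distribution /pushforward/=.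
rewrite -IHn; last by move=> i; exact: mA.
rewrite -product_measure1E//; last first.
  rewrite (_ : mkset _ =
      \bigcap_(i in [set: 'I_n]) ((fun t : n.-tuple mR => tnth t i) @^-1` A (lift ord0 i)))%classic.
    apply: fin_bigcap_measurable; first exact: finite_finset.
    move=> i _; rewrite -[X in measurable X]setTI.
    exact: measurable_tnth.
  by apply/seteqP; split=> t /= At i; [move=> _|]; exact: At.
congr (_ _); apply/seteqP; split=> -[a t] /=.
  move=> At; split; first exact: (At ord0).
  by move=> i; have := At (lift ord0 i); rewrite tnthS.
by move=> [Aa At] i; case: (unliftP ord0 i) => [j|] ->; rewrite ?tnthS//.
Qed.

End UniformRanks.

Section Ratio.
Variable R : realType.

(* E[|R(x)|] / |M*(G)| *)
Definition ranking_ratio (V : finType) (e : rel V) : \bar R :=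
  ('E_(unif_ranks R #|V|)
     [fun t => #|ranking e (fun v => tnth t (enum_rank v))|%:R]
   / (matching_number e)%:R%:E)%E.

Definition approximation_ratio : \bar R :=
  ereal_inf [set r | exists (V : finType) (e : rel V),
    [/\ simple_graph e, exists u v, e u v & r = ranking_ratio e]]%classic.

End Ratio.

(* Main.v *)
From Stdlib Require Import ZArith.
Require Import Defs.
From mathcomp Require Import all_boot all_order all_algebra.
From mathcomp Require Import all_classical all_reals all_analysis measurable_realfun.
From mathcomp Require Import perm zify ring ssrZ.

Set Implicit Arguments.
Unset Strict Implicit.
Unset Printing Implicit Defensive.

Import Order.TTheory GRing.Theory Num.Theory.
Import numFieldNormedType.Exports.

(* RANKING greedily builds the matching in which every vertex prefers partners
   of small rank, so it is the stable matching for these preferences.  An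
   earlier vertex of a matched pair gets the share psi(j) and the later one
   1 - psi(j), where j is the bucket, among 18 buckets of equal length, of the
   rank of the later one.  It suffices that for every edge uv of a maximum
   matching the expected total share of u and v is at least 0.56, and for this
   all ranks other than those of u and v may be fixed, as well as the residues
   of the ranks of u and v modulo the bucket length up to exchange: u and v then
   range over 36 interleaved positions.

   Let mu0 be the output of RANKING without u and v.  At a given position, u
   accepts the neighbours whose partner in mu0 is ranked after u.  The earlier
   of u and v is matched at least as well as to its best accepted neighbour; so
   is the later one, unless the earlier one got hold of a neighbour that it
   accepts too, and even then it is matched at least as well as to any second
   neighbour that it accepts.  Accepted sets shrink along the positions, so
   that one neighbour, the last choice, is accepted as long as anything is.
   Bounding the shares by the ranks of the last choice and of the best accepted
   neighbour at each position leaves a finite minimisation problem, which is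
   decoupled into one problem per position by potentials: for each pair of
   positions the total share is at least a function of the state of the lower
   vertex plus a function of the state of the higher one.  What remains is a
   finite computation for each pair of ranks of the last choices. *)

(** * Stable matchings *)

Section Stable.
Variables (V : finType) (e : rel V) (x : V -> nat).

(** Fixed points of [mu] are the unmatched vertices. The non-strict comparisons let a matched edge
    satisfy the condition by itself. *)
Definition stable (mu : V -> V) : Prop :=
  [/\ involutive mu, forall p, mu p != p -> e p (mu p)
    & forall p q, e p q ->
        (mu p != p) && (x (mu p) <= x q) || (mu q != q) && (x (mu q) <= x p)].

End Stable.

(** * Stable matchings with and without two given vertices *)

Section TwoMatchings.
Variables (V : finType) (e : rel V) (x : V -> nat).
Hypotheses (e_sym : symmetric e) (x_inj : injective x).
Variables (mu mu0 : V -> V) (u v : V).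
Hypothesis neq_uv : u != v.

(* The matching [mu0] leaves out [u] and [v], so it remains stable whatever the
   ranks of these two vertices. *)
Definition off (p : V) := (p != u) && (p != v).
Definition rel_off : rel V := fun p q => [&& e p q, off p & off q].
Definition accepts (y w : V) := [&& e y w, off w & (mu0 w == w) || (x y < x (mu0 w))].

Hypotheses (st : stable e x mu) (st0 : stable rel_off x mu0).

Let muK : involutive mu. Proof. by case: st. Qed.
Let mu0K : involutive mu0. Proof. by case: st0. Qed.
Let mu_edge p : mu p != p -> e p (mu p). Proof. by case: st => _ + _; apply. Qed.
Let mu0_edge p : mu0 p != p -> [&& e p (mu0 p), off p & off (mu0 p)].
Proof. by case: st0 => _ + _; apply. Qed.
Let mu_stable p q : e p q ->
  (mu p != p) && (x (mu p) <= x q) || (mu q != q) && (x (mu q) <= x p).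
Proof. by case: st => _ _; apply. Qed.
Let mu0_stable p q : e p q -> off p -> off q ->
  (mu0 p != p) && (x (mu0 p) <= x q) || (mu0 q != q) && (x (mu0 q) <= x p).
Proof. by move=> epq op oq; case: st0 => _ _; apply; apply/and3P. Qed.

Let ltx p q : p != q -> x p <= x q -> x p < x q.
Proof. by rewrite ltn_neqAle => pq ->; rewrite (inj_eq x_inj) pq. Qed.

Definition prefers0 p := (mu0 p != p) && ((mu p == p) || (x (mu0 p) < x (mu p))).

(** Stability of [mu] at the edge from [p] to [w = mu0 p] gives [w] a partner [p2] in [mu] that it
    prefers to [p]. If [p2] is neither [u] nor [v], stability of [mu0] at the edge [p2 w] passes the
    preference for [mu0] on to [p2], with smaller ranks. *)
Lemma prefers0_step p : prefers0 p ->
  let p2 := mu (mu0 p) in [/\ p2 != mu0 p, x p2 < x p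
   & off p2 -> [/\ prefers0 p2 & x (mu0 p2) < x (mu0 p)]].
Proof.
case/andP=> Np better /=; set w := mu0 p; set p2 := mu w.
have /and3P[epw op ow] := mu0_edge Np.
have Nwp : w != p by [].
have mw : (mu w != w) && (x (mu w) <= x p).
  case/orP: (mu_stable epw) => // /andP[mp le_mp].
  case/orP: better => [/eqP mpp|]; first by rewrite mpp eqxx in mp.
  by move: le_mp; rewrite -/w; lia.
case/andP: mw => Nw lew.
have Np2 : p2 != p.
  apply/eqP => p2p; have mpw : mu p = w by rewrite -p2p /p2 muK.
  by case/orP: better => [/eqP mpp|]; [rewrite mpw in mpp; rewrite mpp eqxx in Nwp|rewrite mpw ltnn].
have ltp2 : x p2 < x p by apply: ltx.
split=> // op2.
have ep2w : e p2 w by have := mu_edge Nw; rewrite e_sym.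
have := mu0_stable ep2w op2 ow.
have w0 : mu0 w = p by rewrite /w mu0K.
case/orP => /andP[]; last by rewrite w0 leqNgt ltp2.
move=> Np20 lep2.
have lt2 : x (mu0 p2) < x w.
  by apply: ltx lep2; apply/eqP => /(canRL mu0K); rewrite w0 => p2p; rewrite p2p eqxx in Np2.
split=> //; rewrite /prefers0 Np20 /= /p2 muK lt2 orbT //.
Qed.

(* The alternating path of the symmetric difference of [mu] and [mu0]. *)
Let next q := mu0 (mu q).

(** Descent on the rank of [p]: the walk back along the alternating path can only stop at [u] or
    [v]. The path is then recorded forwards from that end [y]. *)
Lemma prefers0_chain p : prefers0 p -> exists y k, [/\ (y == u) || (y == v),
   p = iter k.+1 next y,
   forall i, i <= k -> mu0 (mu (iter i next y)) != mu (iter i next y)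
                       /\ x (iter i.+1 next y) <= x p
   & [/\ x y < x (next y), x (mu y) <= x (mu0 p) & mu y != y]].
Proof.
have [n] := ubnP (x p); elim: n p => // n IHn p ltpn pp.
have [Np2 ltp2 step] := prefers0_step pp.
set p2 := mu (mu0 p) in Np2 ltp2 step.
have nextp2 : next p2 = p by rewrite /next /p2 muK mu0K.
have N0 : mu0 (mu p2) != mu p2 by rewrite /p2 muK mu0K eq_sym; case/andP: pp.
case op2: (off p2); last first.
  exists p2, 0; split=> /=.
  - by move: op2; rewrite /off -negb_or => /negbFE.
  - by rewrite nextp2.
  - by move=> i; rewrite leqn0 => /eqP-> /=; rewrite nextp2.
  - by rewrite nextp2 /p2 muK eq_sym; split.
have [pp2 lt0] := step op2.
have [|y [k [yuv p2E ch [lty lemu Nmu]]]] := IHn p2 _ pp2; first by lia.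
exists y, k.+1; split=> //.
- by rewrite iterS -p2E nextp2.
- move=> i; rewrite leq_eqVlt ltnS => /orP[/eqP->|/ch[? le2]].
    by rewrite -p2E N0 iterS -p2E nextp2.
  by split=> //; lia.
- by split=> //; lia.
Qed.

Lemma prefers0_end p : prefers0 p -> exists y, [/\ (y == u) || (y == v),
   accepts y (mu y), mu0 (mu y) != mu y, x y < x (mu0 (mu y)) <= x p
   & x (mu y) <= x (mu0 p)].
Proof.
case/prefers0_chain=> y [k [yuv pE /(_ 0 isT)[N0 /= le1] [lty lemu Nmu]]].
exists y; split=> //; last by rewrite lty.
by rewrite /accepts mu_edge //= lty orbT andbT; case/and3P: (mu0_edge N0).
Qed.

Definition pair_uv (y z : V) := ((y, z) == (u, v)) || ((y, z) == (v, u)).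

Lemma pair_uvP y z : pair_uv y z -> forall p, [/\ (p == u) || (p == v) = (p == y) || (p == z),
  off p = (p != y) && (p != z) & y != z].
Proof.
by case/orP => /eqP[-> ->] p; rewrite /off; split=> //; rewrite 1?eq_sym 1?orbC 1?andbC // eq_sym.
Qed.

(** Otherwise [mu y] prefers [mu0], so it ends a path from [y] or [z]. A start at [y] is excluded
    because [mu y] has its [mu0] partner before [y], a start at [z] because [mu y] itself is ranked
    before [z]. *)
Lemma matched_low_accepts y z : pair_uv y z -> mu y != y -> x (mu y) < x z ->
  accepts y (mu y).
Proof.
move=> yz Nmu ltwz; have [_ offE _] := pair_uvP yz (mu y).
have ow : off (mu y) by rewrite offE Nmu; apply: contraTneq ltwz => ->; rewrite ltnn.
rewrite /accepts mu_edge // ow /=; apply: contraT; rewrite negb_or -leqNgt => /andP[N0 le0].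
have /and3P[_ _ o0] := mu0_edge N0.
have lt0 : x (mu0 (mu y)) < x y.
  by apply: ltx le0; have [_ E _] := pair_uvP yz (mu0 (mu y)); move: o0; rewrite E; case/andP.
have pw : prefers0 (mu y) by rewrite /prefers0 N0 muK lt0 orbT.
have [y' []] := prefers0_end pw; have [-> _ _] := pair_uvP yz y'.
by case/orP => /eqP-> acc N1 /andP[lt1 le1] le2; lia.
Qed.

(** By stability one of the two has a partner ranked no later than the other. If they are not
    partners, it is ranked strictly before, hence accepted by [matched_low_accepts], against the
    assumptions. *)
Lemma matched_together : e u v ->
  (forall w, accepts u w -> x v < x w) -> (forall w, accepts v w -> x u < x w) -> mu u = v.
Proof.
move=> euv accu accv; apply/eqP/contraT => Nuv.
have puv : pair_uv u v by rewrite /pair_uv eqxx.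
have pvu : pair_uv v u by rewrite /pair_uv eqxx orbT.
case/orP: (mu_stable euv) => /andP[Nmu lemu].
  have lt1 : x (mu u) < x v by apply: ltx lemu.
  by have := accu _ (matched_low_accepts puv Nmu lt1); lia.
have lt1 : x (mu v) < x u.
  by apply: ltx lemu; apply: contraNneq Nuv => <-; rewrite muK.
by have := accv _ (matched_low_accepts pvu Nmu lt1); lia.
Qed.

Section Ordered.
Variables y z : V.
Hypotheses (yz : pair_uv y z) (ltyz : x y < x z).

(** Otherwise [w] is matched in [mu] to some [p] ranked before [y], and [p] prefers [mu0]. The path
    leading to [p] would start at [y] or [z], but its start has a smaller rank than [p]. *)
Lemma low_gets_accepted w : accepts y w -> mu y != y /\ x (mu y) <= x w.
Proof.
move=> /and3P[eyw ow acc]; case/orP: (mu_stable eyw) => [/andP[] //|/andP[Nw lew]].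
have [_ offE _] := pair_uvP yz w.
have [mwy|Ny] := eqVneq (mu w) y.
  by rewrite -mwy muK; split=> //; rewrite eq_sym.
set p := mu w in Nw lew Ny; have ltp := ltx Ny lew.
have op : off p.
  have [_ -> _] := pair_uvP yz p; rewrite Ny /=.
  by apply: contraTneq ltyz => <-; rewrite -leqNgt ltnW.
have epw : e p w by rewrite e_sym mu_edge.
have acc' : mu0 w == w \/ x p < x (mu0 w).
  by case/orP: acc => [|/(ltn_trans ltp)]; [left|right].
have pp : prefers0 p.
  case/orP: (mu0_stable epw op ow) => /andP[N0 le0]; last first.
    by case: acc' => [/eqP w0|]; [rewrite w0 eqxx in N0|lia].
  rewrite /prefers0 N0 /= muK; apply/orP; right; apply: ltx le0.
  apply/eqP => /(canRL mu0K) pw; case: acc' => [/eqP w0|]; last by rewrite -pw ltnn.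
  by move: Nw; rewrite pw w0 eqxx.
have [y' []] := prefers0_end pp; have [-> _ _] := pair_uvP yz y'.
by case/orP => /eqP-> _ _ /andP[lt1 le1] _; move: lt1 le1 ltp ltyz; clear; lia.
Qed.

(* Two such [w] lie on the same path from [y], and the first of them would be
   matched in [mu0] to a vertex ranked before [z]: hence [high_gets_backup]. *)
Lemma high_hurt w : accepts z w -> (mu z == z) || (x w < x (mu z)) ->
  exists k, [/\ w = mu (iter k next y),
    forall i, i < k -> mu0 (mu (iter i next y)) != mu (iter i next y)
                       /\ x (iter i.+1 next y) < x z,
    accepts y (mu y) & x (mu y) <= x w].
Proof.
move=> accw hurt; have /and3P[ezw ow acc] := accw.
have /andP[Nw lew] : (mu w != w) && (x (mu w) <= x z).
  case/orP: (mu_stable ezw) => // /andP[Nz lez].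
  by case/orP: hurt => [/eqP mz|]; [rewrite mz eqxx in Nz|lia].
have [_ _ Nyz] := pair_uvP yz w.
set p := mu w in Nw lew.
have Npz : p != z.
  apply: contraTneq hurt => pz; have mz : mu z = w by rewrite -pz muK.
  by rewrite mz ltnn orbF -pz eq_sym.
have ltp := ltx Npz lew.
have [py|Npy] := eqVneq p y.
  exists 0; split=> //=; rewrite -py muK // /accepts ow e_sym mu_edge //=.
  by case/orP: acc => [->//|lt0]; rewrite (ltn_trans ltp lt0) orbT.
have op : off p by have [_ -> _] := pair_uvP yz p; rewrite Npy.
have epw : e p w by rewrite e_sym mu_edge.
have w0P : (mu0 w == w) || (x p < x (mu0 w)).
  by case/orP: acc => [->//|/(ltn_trans ltp)->]; rewrite orbT.
have Nwp : mu0 p != w.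
  apply/eqP => /(canRL mu0K) pw; move: w0P Nw; rewrite pw ltnn orbF => /eqP->.
  by rewrite eqxx.
have [N0 lt0] : mu0 p != p /\ x (mu0 p) < x w.
  case/orP: (mu0_stable epw op ow) => /andP[N0 le0]; first by split; last exact: ltx.
  by move: w0P; rewrite (negPf N0) ltnNge le0.
have pp : prefers0 p by rewrite /prefers0 N0 muK lt0 orbT.
have [y' [k [+ pE ch [lt1 le1 Nmu]]]] := prefers0_chain pp.
have lepz := ltnW ltp.
have [-> _ _] := pair_uvP yz y'; case/orP => /eqP yE; last first.
  have [_ /leq_trans/(_ lepz)] := ch 0 isT; rewrite /= yE leqNgt.
  by rewrite yE in lt1; rewrite lt1.
rewrite yE in pE ch lt1 le1 Nmu; exists k.+1; split.
- by rewrite -pE muK.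
- by move=> i lti; have [? le2] := ch i lti; split=> //; apply: leq_ltn_trans ltp.
- have [N1 _] := ch 0 isT; rewrite /accepts mu_edge // lt1 orbT andbT.
  by case/and3P: (mu0_edge N1).
- exact: leq_trans le1 (ltnW lt0).
Qed.

Lemma high_hurt_cause w : accepts z w -> (mu z == z) || (x w < x (mu z)) ->
  [/\ accepts y (mu y), x (mu y) <= x w
    & mu y = w \/ mu0 (mu y) != mu y /\ x (mu0 (mu y)) < x z].
Proof.
move=> accw /(high_hurt accw)[[|k] [wE ch accy ley]]; split=> //; first by left.
by right; apply: (ch 0).
Qed.

Lemma high_gets_backup w1 w2 : accepts z w1 -> accepts z w2 -> w1 != w2 ->
  x w1 <= x w2 -> mu z != z /\ x (mu z) <= x w2.
Proof.
move=> acc1 acc2 N12 le12; apply/andP; apply: contraT.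
rewrite negb_and negbK -ltnNge => hurt2.
have hurt1 : (mu z == z) || (x w1 < x (mu z)).
  by case/orP: hurt2 => [->//|/(leq_ltn_trans le12)->]; rewrite orbT.
have [k1 [E1 ch1 _ _]] := high_hurt acc1 hurt1.
have [k2 [E2 ch2 _ _]] := high_hurt acc2 hurt2.
have contra k k' w w' : w = mu (iter k next y) -> k < k' -> accepts z w ->
    (forall i, i < k' -> mu0 (mu (iter i next y)) != mu (iter i next y)
       /\ x (iter i.+1 next y) < x z) -> w = w'.
  move=> E ltk acc /(_ _ ltk)[]; rewrite -E iterS /next -E => /negbTE N0 lt0.
  by case/and3P: acc => _ _; rewrite N0 ltnNge (ltnW lt0).
case: (ltngtP k1 k2) => [lt|lt|kE].
- by rewrite (contra _ _ _ w2 E1 lt acc1 ch2) eqxx in N12.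
- by rewrite (contra _ _ _ w1 E2 lt acc2 ch1) eqxx in N12.
- by rewrite E1 E2 kE eqxx in N12.
Qed.

End Ordered.
End TwoMatchings.

(** * RANKING as a stable matching *)

(** Ranks enter only through comparisons; this later replaces real ranks by integers. *)
Lemma eq_ranking (R : realType) (V : finType) (e : rel V) (x x' : V -> R) :
  (forall u v, (x u <= x v)%R = (x' u <= x' v)%R) -> ranking e x = ranking e x'.
Proof.
move=> xx'; have rr : (fun u v => x u <= x v)%R = (fun u v => x' u <= x' v)%R.
  by apply/funext => u; apply/funext => v.
have ss : ranking_step e x =2 ranking_step e x'.
  move=> M v; rewrite /ranking_step /best_nbr; congr (if _ then _ else _).
  rewrite (eq_pick (Q := fun u => free_nbr e M v u && [forall w, free_nbr e M v w ==> (x' u <= x' w)%R])) //.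
  by move=> u; congr (_ && _); apply: eq_forallb => w; rewrite xx'.
by rewrite /ranking rr; elim: (sort _ _) finset.set0 => //= v s IH M; rewrite ss IH.
Qed.

Section Greedy.
Variables (V : finType) (e : rel V).
Hypotheses (e_sym : symmetric e) (e_irr : irreflexive e).

Definition edges_of (mu : V -> V) : {set {set V}} :=
  [set [set p; mu p] | p in [set p | mu p != p]].

Lemma cover_edges_of (mu : V -> V) : involutive mu ->
  finset.cover (edges_of mu) = [set p | mu p != p].
Proof.
move=> muK; apply/setP => p; rewrite inE; apply/bigcupP/idP => [[A /imsetP[q]]|Np].
  by rewrite inE => Nq -> /set2P[]-> //; rewrite muK eq_sym.
by exists [set p; mu p]; [apply: imset_f; rewrite inE|rewrite set21].
Qed.

Lemma card_edges_of (mu : V -> V) : involutive mu ->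
  #|[set p | mu p != p]| = #|edges_of mu|.*2.
Proof.
move=> muK; rewrite -cover_edges_of //.
have /eqP <- : finset.trivIset (edges_of mu).
  apply/finset.trivIsetP => A B /imsetP[p _ ->] /imsetP[q _ ->] neq.
  rewrite -setI_eq0; apply/eqP/setP => r; rewrite !inE; apply: contraNF neq.
  case/andP => /orP[]/eqP-> /orP[]/eqP E.
  - by rewrite E.
  - by rewrite E muK finset.setUC.
  - by rewrite -E muK finset.setUC.
  - by rewrite (inv_inj muK E).
rewrite (eq_bigr (fun=> 2)); first by rewrite sum_nat_const muln2.
move=> A /imsetP[p]; rewrite inE => Np ->.
by rewrite cards2 eq_sym Np.
Qed.

Definition mate (mu : V -> V) (v u p : V) := if p == v then u else if p == u then v else mu p.

Section Step.
Variables (R : realType) (x : V -> R) (k : V -> nat) (S : pred V).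
Hypothesis xk : forall u v, (x u <= x v)%R = (k u <= k v).

(** [T] is the set of processed vertices. Stability is demanded only at edges with a processed end;
    once all vertices are processed this is [stable]. *)
Definition greedy_inv (T : pred V) (M : {set {set V}}) := exists mu, [/\ involutive mu,
  M = edges_of mu, forall p, mu p != p -> e p (mu p) /\ (T p || T (mu p))
  & forall p q, e p q -> T p ->
        (mu p != p) && (k (mu p) <= k q) || (mu q != q) && (k (mu q) <= k p)].

Lemma greedy_step (v : V) M :
  (forall p, S p -> k p < k v) -> (forall p, ~~ S p -> k v <= k p) ->
  greedy_inv S M -> greedy_inv (predU1 v S) (ranking_step e x M v).
Proof.
move=> ltS geS [mu [muK -> mu_e mu_st]]; rewrite /ranking_step cover_edges_of // inE.
(* If [q] is processed this is stability at the edge [qv] with [v] unmatched; if not, the partner of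
   [q] was processed, hence before [v]. *)
have matched_before q : e v q -> mu v == v -> mu q != q -> k (mu q) <= k v.
  move=> evq /eqP mv Nq; have [Sq|NSq] := boolP (S q).
    have := mu_st q v; rewrite e_sym mv eqxx orbF => /(_ evq Sq)/andP[].
    by rewrite Nq.
  by have [_] := mu_e q Nq; rewrite (negPf NSq) /= => /ltS/ltnW.
have [Nv|] := ifPn.
  exists mu; split=> //.
    by move=> p /mu_e[ep /orP[]Sp]; split=> //=; rewrite Sp ?orbT.
  move=> p q epq /= /orP[/eqP pv|]; last exact: mu_st.
  have [Sq|NSq] := boolP (S q).
    by rewrite orbC; apply: mu_st; rewrite // e_sym.
  have [evm] := mu_e v Nv; case Sv: (S v); first by have := ltS _ Sv; rewrite ltnn.
  by move=> /= /ltS lt; rewrite pv Nv (leq_trans (ltnW lt)) ?geS.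
rewrite negbK => mv.
have freeE q : free_nbr e (edges_of mu) v q = e v q && (mu q == q).
  by rewrite /free_nbr cover_edges_of // inE negbK.
rewrite /best_nbr; case: pickP => [u /andP[]|none].
  rewrite freeE => /andP[evu /eqP mu_u] /forallP min_u.
  have Nuv : u != v by apply: contraTneq evu => ->; rewrite e_irr.
  exists (mate mu v u); have mv' := eqP mv; split.
  - move=> p; rewrite /mate; case: (eqVneq p v) => [->|Npv].
      by rewrite (negPf Nuv) eqxx.
    case: (eqVneq p u) => [->|Npu]; first by rewrite eqxx.
    have -> : (mu p == v) = false by apply: contraNF Npv => /eqP E; rewrite -(muK p) E mv'.
    have -> : (mu p == u) = false.
      by apply: contraNF Npu => /eqP E; rewrite -(muK p) E mu_u.
    exact: muK.
  - have mateE p : mu p != p -> mate mu v u p = mu p.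
      rewrite /mate; case: (eqVneq p v) => [->|_]; first by rewrite mv' eqxx.
      by case: (eqVneq p u) => [->|//]; rewrite mu_u eqxx.
    apply/setP => A; rewrite in_setU1; apply/orP/imsetP => [[/eqP->|/imsetP[p]]|[p]].
    + by exists v; rewrite ?inE /mate ?eqxx.
    + rewrite inE => Np ->; exists p; last by rewrite mateE.
      by rewrite inE mateE.
    + rewrite inE /mate; case: (eqVneq p v) => [-> _ ->|Npv]; first by left.
      case: (eqVneq p u) => [-> _ ->|Npu Np ->]; first by left; rewrite finset.setUC.
      by right; apply: imset_f; rewrite inE.
  - move=> p; rewrite /mate /=; case: (eqVneq p v) => [->|Npv]; first by rewrite evu.
    case: (eqVneq p u) => [->|Npu Np]; first by rewrite e_sym evu eqxx orbT.
    by have [? /orP[]->] := mu_e p Np; rewrite ?orbT; split=> //; rewrite ?orbT.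
  - move=> p q epq /= /orP[/eqP pv|Sp].
      rewrite {p}pv in epq *.
      have Nqv : q != v by apply: contraTneq epq => ->; rewrite e_irr.
      rewrite /mate eqxx Nuv /= (negPf Nqv).
      case: (eqVneq q u) => [->|Nqu]; first by rewrite leqnn.
      have [mq|Nq] := eqVneq (mu q) q.
        have := min_u q; rewrite freeE epq mq eqxx /= xk => ->; by rewrite ?orbT.
      by rewrite matched_before ?orbT.
    have := mu_st p q epq Sp; rewrite /mate.
    case: (eqVneq p v) => [pv|Npv].
      by have := ltS _ Sp; rewrite pv ltnn.
    case: (eqVneq q v) => [qv|Nqv].
      rewrite qv mv' eqxx orbF => /andP[Np lep].
      by case: (eqVneq p u) => [pu|_]; [rewrite pu mu_u eqxx in Np|rewrite Np lep].
    case: (eqVneq p u) => [pu|Npu].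
      have := mu_st u v; rewrite e_sym evu mu_u mv' !eqxx => /(_ isT).
      by rewrite -pu => /(_ Sp).
    case: (eqVneq q u) => [qu|Nqu] //.
    by rewrite qu mu_u eqxx orbF => ->.
exists mu; split=> //.
  by move=> p /mu_e[ep /orP[]Sp]; split=> //=; rewrite Sp ?orbT.
(* A free neighbour would yield one of least rank, so a failed search means that every neighbour is
   taken. *)
have exfree q : e v q -> mu q != q.
  move=> evq; apply/negP => mq.
  have [w fw minw] := arg_minnP k (i0 := q) (P := fun w => e v w && (mu w == w)) (introT andP (conj evq mq)).
  have := none w; rewrite freeE fw /= => /forallP[] z.
  by apply/implyP; rewrite freeE xk; apply: minw.
move=> p q epq /= /orP[/eqP pv|]; last exact: mu_st.
by rewrite pv in epq *; rewrite (exfree q epq) (matched_before q epq mv (exfree q epq)) orbT.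
Qed.

End Step.

Lemma ranking_stable (R : realType) (x : V -> R) (k : V -> nat) :
  injective k -> (forall u v, (x u <= x v)%R = (k u <= k v)) ->
  exists2 mu, stable e k mu & #|[set p | mu p != p]| = #|ranking e x|.*2.
Proof.
move=> k_inj xk.
pose s := sort (fun u v => x u <= x v)%R (enum V).
have srt : sorted (fun u v => k u <= k v) s.
  rewrite -(eq_sorted (e := fun u v => x u <= x v)%R); last by move=> ? ?; rewrite xk.
  by apply: sort_sorted => u v; rewrite !xk leq_total.
have us : uniq s by rewrite sort_uniq enum_uniq.
have alls : forall v, v \in s by move=> v; rewrite mem_sort mem_enum.
suff [mu [muK ME mu_e mu_st]] : greedy_inv k (mem s) (ranking e x).
  exists mu; last by rewrite ME card_edges_of.
  split=> // [p /mu_e[]|p q epq] //; exact: mu_st epq (alls p).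
rewrite /ranking -/s.
have : forall s1 s2, s = s1 ++ s2 -> greedy_inv k (mem s1) (foldl (ranking_step e x) finset.set0 s1).
  elim/last_ind => [|s1 v IH] s2 sE.
    exists id; split=> //=.
    - by apply/setP => A; rewrite inE; apply/esym/negP => /imsetP[p]; rewrite inE eqxx.
    - by move=> p; rewrite eqxx.
  rewrite foldl_rcons.
  have sE' : s = s1 ++ v :: s2 by rewrite sE cat_rcons.
  have srt2 : pairwise (fun u v => k u <= k v) (s1 ++ v :: s2).
    by rewrite -sE' -sorted_pairwise //; move=> b a c; exact: leq_trans.
  have := IH _ sE'; move/(greedy_step xk (v := v)).
  move: srt2; rewrite pairwise_cat => /and3P[/allrelP lt1 _ /andP[/allP lt2 _]].
  have vs1 : v \notin s1.
    by move: us; rewrite sE' cat_uniq => /and3P[_ /hasPn/(_ v (mem_head _ _))].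
  case=> [p ps1|p ps1|mu [muK ME mu_e mu_st]].
  - rewrite ltn_neqAle lt1 ?mem_head // andbT (inj_eq k_inj).
    by apply: contraNneq vs1 => <-.
  - have := alls p; rewrite sE' mem_cat (negPf (ps1 : p \notin s1)) /= inE.
    by case/orP => [/eqP->//|/lt2].
  - exists mu; split=> // [p /mu_e[? h]|p q epq]; last first.
      by rewrite /= mem_rcons inE; apply: mu_st.
    by split=> //; rewrite /= !mem_rcons !inE.
by move=> /(_ s [::]); rewrite cats0; apply.
Qed.

End Greedy.

(* [Same]: both vertices have the same last choice.  Otherwise the level of the
   last choice of the lower vertex is at most ([Below]) or above ([Above]) the
   level of the last choice of the higher vertex. *)
Inductive regime := Same | Below | Above.

(** * Numerical tables of shares and potentials *)

Local Open Scope Z_scope.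

(* The tables come from a numerical optimisation; their unit is 1/200. *)
Definition psi_table : seq Z := [:: 100; 100; 98; 98; 96; 94; 90; 87; 82; 81; 74; 71; 64; 57; 52; 47; 45; 44].

Definition pot_same : seq (seq (seq (Z * Z * Z * Z))) :=
 [:: [:: [:: (67,67,17,0); (77,77,12,0); (17,17,17,0); (21,21,2,0); (20,20,7,0); (21,21,16,0); (12,12,0,0); (4,4,0,0); (5,5,0,0); (26,26,0,0)];
 [:: (64,64,7,0); (48,48,12,0); (31,31,16,0); (18,18,11,0); (9,9,0,0); (13,13,1,0); (12,12,0,0); (13,13,0,0); (16,16,0,0)];
 [:: (27,27,17,0); (33,33,16,0); (21,21,11,0); (17,17,0,0); (19,19,1,0); (17,17,0,0); (18,18,0,0); (11,11,0,0)];
 [:: (21,21,14,0); (17,17,9,0); (15,15,17,0); (17,17,1,0); (14,14,0,0); (14,14,0,0); (15,15,0,0)];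
 [:: (26,26,6,0); (9,9,2,0); (9,9,2,0); (1,1,0,0); (7,7,0,0); (12,12,0,0)];
 [:: (12,12,1,0); (2,2,3,0); (0,0,1,0); (0,0,0,0); (6,6,0,0)];
 [:: (-8,-8,2,0); (-1,-1,0,0); (-4,-4,0,0); (-1,-1,0,0)];
 [:: (-7,-7,0,0); (-6,-6,0,0); (-1,-1,0,0)];
 [:: (-13,-13,0,0); (-15,-15,0,0)];
 [:: (-17,-17,0,0)]];
 [:: [:: (96,98,22,0); (73,75,16,0); (15,15,2,0); (27,27,17,0); (14,14,4,0); (14,14,14,0); (6,6,3,0); (-4,-4,0,0); (0,0,0,0); (33,33,0,0)];
 [:: (46,48,10,0); (46,46,12,0); (13,13,3,0); (17,17,20,0); (6,6,0,0); (13,13,1,0); (9,9,1,0); (14,14,0,0); (49,49,0,0)];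
 [:: (17,17,1,0); (24,24,2,0); (31,31,10,0); (17,17,1,0); (25,25,2,0); (21,21,1,0); (20,20,0,0); (1,1,0,0)];
 [:: (39,39,16,0); (22,22,9,0); (7,7,0,0); (21,21,2,0); (15,15,1,0); (17,17,0,0); (10,10,0,0)];
 [:: (26,26,6,0); (10,10,5,0); (10,10,2,0); (4,4,0,0); (3,3,0,0); (4,4,0,0)];
 [:: (17,17,4,0); (10,10,2,0); (3,3,1,0); (3,3,0,0); (2,2,0,0)];
 [:: (0,0,3,0); (-5,-5,1,0); (-2,-2,0,0); (-3,-3,0,0)];
 [:: (-7,-7,0,0); (-7,-7,0,0); (-5,-5,0,0)];
 [:: (-15,-15,0,0); (-17,-17,0,0)];
 [:: (-10,-10,0,0)]];
 [:: [:: (103,104,11,0); (85,89,28,0); (62,67,16,0); (8,8,8,0); (7,7,14,0); (9,9,10,0); (-1,-1,1,0); (-1,-1,0,0); (-9,-9,0,0); (24,24,0,0)];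
 [:: (83,87,13,0); (42,49,16,0); (16,16,5,0); (6,6,10,0); (2,2,5,0); (1,1,2,0); (2,2,0,0); (8,8,0,0); (51,51,0,0)];
 [:: (19,22,21,0); (25,25,4,0); (24,24,5,0); (14,14,2,0); (15,15,3,0); (14,14,0,0); (18,18,0,0); (12,12,0,0)];
 [:: (18,18,1,0); (26,26,4,0); (19,19,3,0); (17,17,1,0); (18,18,0,0); (21,21,0,0); (0,0,0,0)];
 [:: (25,25,14,0); (10,10,2,0); (12,12,2,0); (5,5,0,0); (10,10,0,0); (0,0,0,0)];
 [:: (23,23,7,0); (8,8,2,0); (2,2,0,0); (2,2,0,0); (0,0,0,0)];
 [:: (0,0,0,0); (-1,-1,0,0); (-9,-9,0,0); (-1,-1,0,0)];
 [:: (-2,-2,0,0); (-6,-6,0,0); (-2,-2,0,0)];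
 [:: (-8,-8,0,0); (-12,-12,0,0)];
 [:: (-10,-10,0,0)]];
 [:: [:: (99,100,12,0); (86,97,25,0); (67,78,25,0); (37,68,7,0); (-3,-3,10,0); (4,4,0,0); (-3,-3,3,0); (-13,-13,0,0); (-16,-16,0,0); (17,17,0,0)];
 [:: (83,92,27,0); (81,93,11,0); (33,43,21,0); (-6,-6,1,0); (-6,-6,10,0); (-2,-2,2,0); (-5,-5,0,0); (1,1,0,0); (41,41,0,0)];
 [:: (39,51,39,0); (23,32,30,0); (13,13,0,0); (16,16,9,0); (14,14,0,0); (6,6,0,0); (10,10,0,0); (17,17,0,0)];
 [:: (-15,20,19,0); (39,39,13,0); (37,37,8,0); (34,34,1,0); (26,26,1,0); (23,23,0,0); (-3,-3,0,0)];
 [:: (19,19,10,0); (22,22,10,0); (16,16,0,0); (14,14,1,0); (8,8,0,0); (-1,-1,0,0)];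
 [:: (5,5,9,0); (-1,-1,1,0); (-1,-1,0,0); (-1,-1,0,0); (-2,-2,0,0)];
 [:: (-4,-4,5,0); (0,0,1,0); (-2,-2,0,0); (-1,-1,0,0)];
 [:: (-2,-2,0,0); (0,0,0,0); (-2,-2,0,0)];
 [:: (-9,-9,0,0); (-2,-2,0,0)];
 [:: (-14,-14,0,0)]];
 [:: [:: (88,88,7,0); (71,88,21,0); (62,80,17,0); (47,77,4,0); (1,75,4,0); (-4,-4,0,0); (-8,-8,0,0); (-11,-11,1,0); (-11,-11,0,0); (16,16,0,0)];
 [:: (82,91,11,0); (72,89,11,0); (55,77,5,0); (22,38,8,0); (-19,-19,4,0); (-17,-17,4,0); (-15,-15,1,0); (-10,-10,0,0); (36,36,0,0)];
 [:: (62,79,10,0); (39,53,23,0); (10,22,22,0); (1,1,2,0); (1,1,3,0); (-3,-3,1,0); (3,3,0,0); (32,32,0,0)];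
 [:: (20,39,39,0); (-4,21,20,0); (31,31,11,0); (26,26,1,0); (15,15,0,0); (19,19,0,0); (3,3,0,0)];
 [:: (-63,15,15,0); (47,47,10,0); (47,47,1,0); (45,45,1,0); (38,38,0,0); (-2,-2,0,0)];
 [:: (15,15,13,0); (1,1,4,0); (1,1,1,0); (0,0,0,0); (-1,-1,0,0)];
 [:: (1,1,2,0); (-1,-1,1,0); (-4,-4,0,0); (-2,-2,0,0)];
 [:: (-3,-3,0,0); (-3,-3,0,0); (-10,-10,0,0)];
 [:: (-12,-12,0,0); (-14,-14,0,0)];
 [:: (-7,-7,0,0)]];
 [:: [:: (77,77,6,0); (68,81,13,0); (54,77,8,0); (44,71,2,0); (21,72,4,0); (10,73,3,0); (-13,-13,3,0); (-17,-17,1,0); (-18,-18,0,0); (7,7,0,0)];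
 [:: (84,85,14,0); (60,85,11,0); (55,79,8,0); (50,72,1,0); (28,44,11,0); (-48,-48,2,0); (-27,-27,1,0); (-26,-26,0,0); (25,25,0,0)];
 [:: (63,79,9,0); (47,73,4,0); (28,54,7,0); (-7,22,21,0); (-16,-16,2,0); (-8,-8,1,0); (-2,-2,0,0); (20,20,0,0)];
 [:: (36,57,8,0); (11,34,34,0); (-13,21,21,0); (29,29,4,0); (13,13,0,0); (14,14,0,0); (10,10,0,0)];
 [:: (-22,25,25,0); (-4,12,12,0); (36,36,0,0); (24,24,2,0); (25,25,0,0); (5,5,0,0)];
 [:: (-71,4,4,0); (65,65,6,0); (42,42,2,0); (40,40,0,0); (8,8,0,0)];
 [:: (-5,-5,4,0); (-1,-1,1,0); (-2,-2,0,0); (-5,-5,0,0)];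
 [:: (-2,-2,1,0); (-7,-7,0,0); (-9,-9,0,0)];
 [:: (-10,-10,0,0); (-11,-11,0,0)];
 [:: (-9,-9,0,0)]];
 [:: [:: (60,60,-4,0); (62,63,5,0); (59,59,2,0); (54,62,5,0); (31,62,5,0); (4,58,1,0); (19,60,4,0); (-32,-32,1,0); (-35,-35,0,0); (-5,-5,0,0)];
 [:: (71,72,7,0); (49,72,8,0); (52,74,10,0); (35,66,8,0); (38,63,6,0); (31,68,11,0); (-41,-41,1,0); (-32,-32,0,0); (0,0,0,0)];
 [:: (63,65,1,0); (35,72,8,0); (30,62,4,0); (33,59,1,0); (12,31,18,0); (-17,-17,1,0); (-26,-26,0,0); (-1,-1,0,0)];
 [:: (46,59,1,0); (32,62,5,0); (14,41,20,0); (-8,24,24,0); (7,7,1,0); (1,1,0,0); (10,10,0,0)];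
 [:: (22,50,20,0); (1,31,31,0); (-16,23,23,0); (31,31,1,0); (30,30,0,0); (12,12,0,0)];
 [:: (-44,20,26,0); (-10,8,9,0); (30,30,0,0); (34,34,0,0); (3,3,0,0)];
 [:: (-61,3,3,0); (42,42,1,0); (47,47,0,0); (34,34,0,0)];
 [:: (-2,-2,2,0); (-6,-6,0,0); (-6,-6,0,0)];
 [:: (-5,-5,0,0); (-7,-7,0,0)];
 [:: (-15,-15,0,0)]];
 [:: [:: (48,48,-23,0); (52,52,-16,0); (43,52,0,0); (18,54,2,0); (-8,51,4,0); (11,49,2,0); (34,48,1,0); (46,46,0,0); (-20,-20,0,0); (-7,-7,0,0)];
 [:: (56,56,2,0); (52,53,-9,0); (52,57,3,0); (47,56,4,0); (32,55,4,0); (-1,56,6,0); (2,48,2,0); (-34,-34,0,0); (-17,-17,0,0)];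
 [:: (48,54,-1,0); (35,59,4,0); (32,57,5,0); (25,56,4,0); (29,55,7,0); (3,48,2,0); (-8,-8,0,0); (-16,-16,0,0)];
 [:: (31,57,2,0); (16,57,5,0); (23,55,4,0); (26,55,7,0); (7,38,4,0); (7,7,0,0); (-10,-10,0,0)];
 [:: (16,54,3,0); (21,55,4,0); (22,53,12,0); (-2,20,22,0); (12,12,0,0); (-3,-3,0,0)];
 [:: (4,49,17,0); (9,38,38,0); (3,20,21,0); (14,14,0,0); (16,16,0,0)];
 [:: (-23,25,35,0); (-16,18,20,0); (7,7,0,0); (24,24,0,0)];
 [:: (-32,-13,18,0); (28,28,0,0); (36,36,0,0)];
 [:: (-1,-1,0,0); (-2,-2,0,0)];
 [:: (-2,-2,0,0)]];
 [:: [:: (41,42,-23,0); (43,45,-23,0); (20,48,-23,0); (9,47,-23,0); (-13,45,-21,0); (26,43,-11,0); (33,40,-9,0); (33,38,-7,0); (29,38,-1,0); (10,10,0,0)];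
 [:: (52,52,-23,0); (45,50,-23,0); (36,52,-23,0); (34,50,-16,0); (23,46,1,0); (19,44,0,0); (8,45,1,0); (2,43,1,0); (-3,-3,0,0)];
 [:: (41,46,-23,0); (33,49,-23,0); (29,50,-16,0); (34,45,0,0); (21,45,0,0); (7,45,1,0); (-1,43,1,0); (-6,-6,0,0)];
 [:: (29,48,-23,0); (16,50,-16,0); (23,45,0,0); (20,45,0,0); (28,46,2,0); (7,43,1,0); (-2,-2,0,0)];
 [:: (15,45,-9,0); (-2,45,0,0); (11,45,0,0); (21,45,3,0); (22,37,4,0); (7,7,0,0)];
 [:: (-19,45,-1,0); (5,44,0,0); (6,40,8,0); (30,23,15,0); (18,18,0,0)];
 [:: (-8,41,3,0); (2,34,12,0); (8,16,21,0); (22,22,0,0)];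
 [:: (-23,23,23,0); (-23,11,18,0); (8,8,0,0)];
 [:: (-34,-8,13,0); (-21,-21,0,0)];
 [:: (-7,-7,-2,0)]];
 [:: [::];
 [:: (46,46,-23,0); (34,48,-23,0); (29,47,-23,0); (18,48,-23,0); (25,47,-23,0); (23,42,-17,0); (-2,41,-13,0); (10,41,-6,0); (11,32,-2,0)];
 [:: (38,46,-23,0); (34,45,-23,0); (42,46,-23,0); (23,47,-23,0); (14,42,-17,0); (-6,41,-13,0); (4,41,-6,0); (8,32,-2,0)];
 [:: (25,45,-23,0); (26,46,-23,0); (34,47,-23,0); (22,42,-17,0); (4,41,-13,0); (-6,41,-6,0); (9,32,-2,0)];
 [:: (11,45,-23,0); (7,47,-23,0); (29,42,-17,0); (21,41,-13,0); (3,41,-6,0); (10,32,-2,0)];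
 [:: (-1,45,-22,0); (0,42,-17,0); (9,41,-13,0); (-5,41,-6,0); (10,31,-2,0)];
 [:: (-26,41,-14,0); (10,40,-13,0); (9,38,-6,0); (9,25,2,0)];
 [:: (-19,39,-12,0); (18,35,-6,0); (14,21,4,0)];
 [:: (0,31,-1,0); (-11,15,4,0)];
 [:: (-52,1,9,0)]]].

Definition pot_below : seq (seq (seq (Z * Z * Z * Z))) :=
 [:: [:: [:: (61,64,0,0); (60,60,3,3); (39,39,7,7); (16,16,1,1); (11,11,0,0); (18,18,0,0); (11,11,0,0); (4,4,0,0); (5,5,0,0); (13,13,0,0)];
 [:: (57,57,16,16); (59,59,20,20); (41,41,13,13); (23,23,0,0); (12,12,0,0); (5,5,0,0); (4,4,0,0); (1,1,0,0); (7,7,0,0)];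
 [:: (48,48,22,22); (41,41,27,27); (24,24,13,13); (11,11,2,2); (3,3,0,0); (0,0,0,0); (2,2,0,0); (0,0,0,0)];
 [:: (26,26,18,18); (21,21,21,21); (12,12,12,12); (4,4,4,4); (0,0,0,0); (0,0,0,0); (0,0,0,0)];
 [:: (18,18,13,13); (16,16,16,16); (9,9,9,9); (3,3,3,3); (0,0,0,0); (0,0,0,0)];
 [:: (5,5,5,5); (9,9,9,9); (3,3,3,3); (0,0,0,0); (0,0,0,0)];
 [:: (0,0,0,0); (0,0,0,0); (0,0,0,0); (0,0,0,0)];
 [:: (0,0,0,0); (0,0,0,0); (0,0,0,0)];
 [:: (0,0,0,0); (0,0,0,0)];
 [:: (0,0,0,0)]];
 [:: [:: (81,82,0,0); (65,66,0,0); (39,39,4,4); (21,21,0,0); (9,9,0,0); (1,1,0,0); (-1,-1,0,0); (1,1,0,0); (4,4,0,0); (16,16,0,0)];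
 [:: (43,58,9,9); (52,52,21,21); (41,41,13,13); (26,26,0,0); (19,19,0,0); (14,14,0,0); (2,2,0,0); (4,4,0,0); (9,9,0,0)];
 [:: (45,45,21,21); (40,40,29,29); (24,24,12,12); (14,14,0,0); (5,5,0,0); (5,5,0,0); (0,0,0,0); (0,0,0,0)];
 [:: (27,27,22,22); (23,23,23,23); (12,12,12,12); (3,3,3,3); (0,0,0,0); (0,0,0,0); (0,0,0,0)];
 [:: (18,18,16,16); (18,18,18,18); (10,10,10,10); (2,2,2,2); (0,0,0,0); (0,0,0,0)];
 [:: (9,9,9,9); (10,10,10,10); (3,3,3,3); (0,0,0,0); (0,0,0,0)];
 [:: (0,0,0,0); (1,1,1,1); (0,0,0,0); (0,0,0,0)];
 [:: (0,0,0,0); (0,0,0,0); (0,0,0,0)];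
 [:: (0,0,0,0); (0,0,0,0)];
 [:: (-1,-1,-1,0)]];
 [:: [:: (80,86,0,0); (69,74,0,0); (44,69,5,4); (20,20,0,0); (8,8,0,0); (-1,-1,0,0); (-6,-6,0,0); (0,0,0,0); (4,4,0,0); (18,18,0,0)];
 [:: (58,68,6,6); (51,55,18,18); (40,40,15,15); (24,24,0,0); (14,14,0,0); (8,8,0,0); (-2,-2,0,0); (-3,-3,0,0); (20,20,0,0)];
 [:: (18,38,30,20); (44,44,27,27); (29,29,12,12); (19,19,0,0); (14,14,0,0); (10,10,0,0); (8,8,0,0); (-13,-13,0,0)];
 [:: (25,25,23,23); (22,22,22,22); (11,11,11,11); (1,1,1,1); (0,0,0,0); (0,0,0,0); (0,0,0,0)];
 [:: (16,16,16,16); (18,18,18,18); (9,9,9,9); (2,2,2,2); (0,0,0,0); (0,0,0,0)];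
 [:: (9,9,9,9); (11,11,11,11); (2,2,2,2); (0,0,0,0); (0,0,0,0)];
 [:: (0,0,0,0); (1,1,1,1); (0,0,0,0); (0,0,0,0)];
 [:: (0,0,0,0); (0,0,0,0); (0,0,0,0)];
 [:: (0,0,0,0); (0,0,0,0)];
 [:: (-1,-1,-1,0)]];
 [:: [:: (80,87,0,0); (60,71,0,0); (50,62,1,0); (24,69,1,1); (5,5,0,0); (-3,-3,0,0); (-10,-10,0,0); (-2,-2,0,0); (1,1,0,0); (22,22,0,0)];
 [:: (61,72,2,2); (50,60,2,1); (40,62,34,34); (19,19,0,0); (6,6,0,0); (3,3,0,0); (2,2,0,0); (1,1,0,0); (35,35,0,0)];
 [:: (33,48,31,8); (36,50,44,44); (38,38,0,0); (24,24,0,0); (21,21,0,0); (13,13,0,0); (12,12,0,0); (4,4,0,0)];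
 [:: (8,48,43,43); (23,23,26,26); (7,7,3,3); (1,1,0,0); (-5,-5,0,0); (-5,-5,0,0); (-30,-30,0,0)];
 [:: (14,14,14,14); (25,25,25,25); (11,11,11,11); (2,2,2,2); (0,0,0,0); (0,0,0,0)];
 [:: (4,4,4,4); (12,12,12,12); (4,4,4,4); (0,0,0,0); (0,0,0,0)];
 [:: (0,0,0,0); (0,0,0,0); (0,0,0,0); (0,0,0,0)];
 [:: (0,0,0,0); (0,0,0,0); (0,0,0,0)];
 [:: (0,0,0,0); (0,0,0,0)];
 [:: (0,0,0,0)]];
 [:: [:: (79,81,0,0); (63,79,0,0); (46,64,1,0); (21,69,1,0); (15,64,0,0); (-2,-2,0,0); (-11,-11,0,0); (-4,-4,0,0); (-2,-2,0,0); (24,24,0,0)];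
 [:: (67,81,0,0); (53,71,0,0); (34,49,1,0); (27,75,32,33); (8,8,0,0); (-7,-7,0,0); (-5,-5,0,0); (-2,-2,0,0); (50,50,0,0)];
 [:: (32,47,0,0); (23,47,1,0); (31,54,48,48); (22,22,0,0); (15,15,0,0); (11,11,0,0); (11,11,0,0); (24,24,0,0)];
 [:: (-11,36,33,0); (26,50,49,50); (48,48,0,0); (34,34,0,0); (32,32,0,0); (31,31,0,0); (-23,-23,0,0)];
 [:: (8,58,58,58); (-15,-15,22,22); (-17,-17,0,0); (-28,-28,0,0); (-31,-31,0,0); (-42,-42,0,0)];
 [:: (0,0,0,0); (25,25,26,26); (6,6,7,7); (0,0,1,1); (-1,-1,0,0)];
 [:: (0,0,0,0); (1,1,2,2); (0,0,0,0); (0,0,0,0)];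
 [:: (0,0,0,0); (0,0,0,0); (0,0,0,0)];
 [:: (0,0,0,0); (-1,-1,0,0)];
 [:: (-1,-1,0,0)]];
 [:: [:: (71,71,0,0); (56,71,0,0); (46,69,0,0); (24,71,0,0); (14,70,0,0); (22,65,0,0); (-13,-13,0,0); (-7,-7,0,0); (-3,-3,0,0); (18,18,0,0)];
 [:: (65,71,0,0); (47,71,0,0); (48,71,1,0); (19,59,0,0); (10,65,22,22); (-2,-2,0,0); (-6,-6,0,0); (-6,-6,0,0); (44,44,0,0)];
 [:: (52,71,1,0); (41,64,0,0); (19,46,8,8); (26,59,51,51); (11,11,0,0); (6,6,0,0); (5,5,0,0); (28,28,0,0)];
 [:: (-4,37,3,0); (6,32,14,13); (20,33,32,32); (37,37,0,0); (27,27,0,0); (21,21,0,0); (22,22,0,0)];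
 [:: (-31,28,28,0); (17,46,46,46); (46,46,0,0); (37,37,0,0); (32,32,0,0); (-43,-43,0,0)];
 [:: (-1,62,62,62); (-44,-44,20,20); (-53,-53,0,0); (-47,-47,0,0); (-44,-44,0,0)];
 [:: (-1,-1,2,2); (9,9,10,10); (0,0,1,1); (-1,-1,0,0)];
 [:: (-1,-1,0,0); (0,0,0,0); (-1,-1,0,0)];
 [:: (0,0,0,0); (-1,-1,0,0)];
 [:: (-1,-1,0,0)]];
 [:: [:: (58,58,-11,0); (57,58,0,0); (34,58,0,0); (16,57,0,0); (7,57,0,0); (27,57,0,0); (28,57,0,0); (-13,-13,0,0); (-5,-5,0,0); (17,17,0,0)];
 [:: (64,64,0,0); (45,64,0,0); (40,64,0,0); (26,58,0,0); (13,58,0,0); (24,57,0,0); (-16,-16,0,0); (-16,-16,0,0); (25,25,0,0)];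
 [:: (42,60,1,0); (30,65,0,0); (26,57,0,0); (27,57,0,0); (5,56,36,36); (17,17,0,0); (13,13,0,0); (12,12,0,0)];
 [:: (37,57,0,0); (24,57,0,0); (23,58,43,43); (18,37,37,37); (32,32,0,0); (23,23,0,0); (14,14,0,0)];
 [:: (-18,31,0,0); (1,40,40,40); (4,23,23,23); (55,55,0,0); (46,46,0,0); (20,20,0,0)];
 [:: (-1,30,30,30); (-10,47,47,47); (-16,-16,1,1); (-13,-13,0,0); (-23,-23,0,0)];
 [:: (-34,28,30,30); (-48,-48,10,9); (-46,-46,1,1); (-44,-44,0,0)];
 [:: (0,0,0,0); (0,0,0,0); (-1,-1,0,0)];
 [:: (0,0,0,0); (-1,-1,0,0)];
 [:: (0,0,0,0)]];
 [:: [:: (48,49,-23,0); (51,52,-15,0); (25,56,-19,0); (4,52,-11,0); (8,52,0,0); (20,47,0,0); (42,47,0,0); (25,41,0,0); (-3,-3,0,0); (16,16,0,0)];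
 [:: (52,53,-7,0); (44,57,-1,0); (34,53,-1,0); (23,52,-2,0); (16,52,0,0); (0,47,0,0); (10,46,0,0); (-14,-14,0,0); (38,38,0,0)];
 [:: (27,56,-1,0); (19,52,-1,0); (17,52,0,0); (17,52,0,0); (24,47,0,0); (15,46,0,0); (12,12,0,0); (2,2,0,0)];
 [:: (20,53,-3,0); (12,53,-1,0); (16,52,0,0); (28,47,0,0); (18,43,22,22); (34,34,0,0); (-5,-5,0,0)];
 [:: (22,52,0,0); (8,52,0,0); (22,47,31,31); (24,44,44,44); (42,42,0,0); (31,31,0,0)];
 [:: (22,49,26,27); (-10,39,39,39); (-11,19,19,19); (29,29,0,0); (25,25,0,0)];
 [:: (-13,44,44,44); (-28,29,29,29); (-46,-46,1,1); (-44,-44,0,0)];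
 [:: (-57,-6,0,0); (-52,-52,0,0); (-45,-45,0,0)];
 [:: (0,0,0,0); (-1,-1,0,0)];
 [:: (-1,-1,0,0)]];
 [:: [:: (44,45,-23,0); (45,46,-23,0); (21,50,-23,0); (10,49,-23,0); (4,46,-17,0); (19,45,-2,0); (26,44,-3,0); (-2,44,-1,0); (42,40,0,0); (15,15,0,0)];
 [:: (47,47,-23,0); (43,52,-23,0); (36,52,-23,0); (24,49,-12,0); (12,46,-7,0); (-3,45,0,0); (5,44,0,0); (-2,33,0,0); (44,44,0,0)];
 [:: (21,57,-23,0); (21,54,-23,0); (15,49,-12,0); (15,45,-7,0); (19,45,-1,0); (6,44,0,0); (18,35,0,0); (15,15,0,0)];
 [:: (15,52,-22,0); (7,48,-12,0); (11,45,-5,0); (23,44,0,1); (37,44,0,0); (8,40,0,0); (1,1,0,0)];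
 [:: (4,46,-3,0); (8,45,-3,0); (20,44,0,1); (32,44,10,10); (38,41,11,11); (1,1,0,0)];
 [:: (15,44,-2,0); (-1,44,4,6); (15,44,28,28); (21,33,24,24); (24,24,0,0)];
 [:: (24,44,22,22); (-9,38,19,19); (-10,20,21,20); (10,10,0,0)];
 [:: (-29,13,13,13); (-47,0,0,0); (-44,-44,0,0)];
 [:: (-46,-6,0,0); (-45,-45,0,0)];
 [:: (-2,-2,0,0)]];
 [:: [::];
 [:: (45,45,-23,0); (46,48,-23,0); (40,48,-23,0); (35,49,-23,0); (27,47,-23,0); (16,44,-17,0); (-1,44,-5,0); (-9,37,-2,0); (-8,34,0,0)];
 [:: (32,47,-23,0); (23,49,-23,0); (21,51,-23,0); (25,47,-23,0); (26,44,-17,0); (10,44,-5,0); (-2,38,-2,0); (-3,34,0,0)];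
 [:: (13,49,-23,0); (11,50,-23,0); (16,47,-23,0); (20,44,-17,0); (28,44,-5,0); (8,37,-2,0); (3,34,0,0)];
 [:: (11,48,-23,0); (8,47,-23,0); (9,44,-17,0); (26,44,-5,0); (25,38,0,0); (8,34,0,0)];
 [:: (11,44,-23,0); (-3,44,-17,0); (25,43,-5,0); (26,36,0,0); (26,34,0,0)];
 [:: (17,44,-13,0); (-8,40,-5,0); (19,32,0,0); (19,33,0,0)];
 [:: (8,20,0,5); (-15,31,0,0); (7,31,0,0)];
 [:: (-6,25,-1,0); (-13,25,0,0)];
 [:: (-30,7,0,0)]]].

Definition pot_above : seq (seq (seq (Z * Z * Z * Z))) :=
 [:: [:: [:: (56,71,0,0); (54,54,2,0); (47,47,0,0); (33,33,0,0); (27,27,0,0); (22,22,0,0); (7,7,0,0); (-21,-21,0,0); (-19,-19,0,0); (13,13,0,0)];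
 [:: (44,44,17,0); (42,42,20,0); (49,49,0,0); (40,40,0,0); (13,13,0,0); (0,0,0,0); (0,0,0,0); (0,0,0,0); (0,0,0,0)];
 [:: (34,34,14,0); (19,19,19,0); (17,17,0,0); (46,46,0,0); (21,21,0,0); (0,0,0,0); (0,0,0,0); (0,0,0,0)];
 [:: (2,2,1,0); (16,16,16,0); (5,5,4,0); (28,28,1,0); (28,28,0,0); (0,0,0,0); (0,0,0,0)];
 [:: (0,0,0,0); (16,16,16,0); (7,7,7,0); (8,8,8,0); (18,18,0,0); (6,6,0,0)];
 [:: (2,2,2,0); (16,16,16,0); (2,2,2,0); (6,6,6,0); (2,2,2,0)];
 [:: (3,3,3,0); (3,3,3,0); (1,1,1,0); (6,6,6,0)];
 [:: (-2,-2,-2,0); (0,0,0,0); (0,0,0,0)];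
 [:: (-3,-3,-3,0); (-3,-3,-3,0)];
 [:: (-5,-5,-4,0)]];
 [:: [:: (81,86,0,0); (65,75,0,0); (46,46,5,0); (27,27,0,0); (17,17,0,0); (7,7,0,0); (-2,-2,0,0); (-13,-13,0,0); (-5,-5,0,0); (21,21,0,0)];
 [:: (40,57,6,0); (31,31,5,0); (53,53,0,0); (50,50,0,0); (34,34,0,0); (17,17,0,0); (-23,-23,0,0); (-37,-37,0,0); (8,8,0,0)];
 [:: (40,40,21,0); (16,16,16,0); (12,12,0,0); (34,34,0,0); (33,33,0,0); (1,1,0,0); (0,0,0,0); (0,0,0,0)];
 [:: (4,4,4,0); (15,15,15,0); (6,6,6,0); (5,5,1,0); (43,43,0,0); (9,9,0,0); (0,0,0,0)];
 [:: (0,0,0,0); (15,15,15,0); (6,6,6,0); (9,9,9,0); (28,28,0,0); (0,0,0,0)];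
 [:: (3,3,3,0); (17,17,17,0); (1,1,1,0); (9,9,5,0); (2,2,2,0)];
 [:: (3,3,3,0); (4,4,4,0); (2,2,2,0); (5,5,5,0)];
 [:: (-2,-2,-2,0); (0,0,0,0); (0,0,0,0)];
 [:: (-3,-3,-3,0); (-3,-3,-3,0)];
 [:: (-5,-5,-4,0)]];
 [:: [:: (85,89,0,0); (70,79,0,0); (43,74,11,0); (36,36,0,0); (18,18,0,0); (9,9,0,0); (-5,-5,0,0); (-20,-20,0,0); (-4,-4,0,0); (18,18,0,0)];
 [:: (57,72,7,0); (33,49,11,0); (49,49,0,0); (40,40,0,0); (39,39,0,0); (18,18,0,0); (-20,-20,0,0); (-44,-44,0,0); (22,22,0,0)];
 [:: (18,40,22,0); (0,0,0,0); (23,23,0,0); (29,29,0,0); (38,38,0,0); (16,16,0,0); (-7,-7,0,0); (-17,-17,0,0)];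
 [:: (15,15,15,0); (10,10,10,0); (6,6,6,0); (2,2,2,0); (28,28,0,0); (25,25,0,0); (0,0,0,0)];
 [:: (0,0,0,0); (14,14,14,0); (6,6,6,0); (10,10,10,0); (28,28,0,0); (0,0,0,0)];
 [:: (4,4,4,0); (15,15,15,0); (1,1,1,0); (8,8,6,0); (1,1,1,0)];
 [:: (4,4,4,0); (2,2,2,0); (0,0,0,0); (7,7,7,0)];
 [:: (-3,-3,-3,0); (-1,-1,-1,0); (-1,-1,-1,0)];
 [:: (-3,-3,-3,0); (-3,-3,-3,0)];
 [:: (-4,-4,-4,0)]];
 [:: [:: (83,88,0,0); (73,82,0,0); (44,66,1,0); (28,74,14,0); (23,23,0,0); (14,14,0,0); (0,0,0,0); (-25,-25,0,0); (-2,-2,0,0); (18,18,0,0)];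
 [:: (55,71,0,0); (42,61,14,0); (32,56,11,0); (50,50,0,0); (46,46,0,0); (21,21,0,0); (-26,-26,0,0); (-43,-43,0,0); (35,35,0,0)];
 [:: (31,53,23,0); (10,40,24,0); (23,23,0,0); (34,34,0,0); (43,43,0,0); (12,12,0,0); (-10,-10,0,0); (0,0,0,0)];
 [:: (-7,30,22,0); (-5,-5,0,0); (-5,-5,0,0); (5,5,0,0); (46,46,0,0); (28,28,0,0); (-33,-33,0,0)];
 [:: (0,0,0,0); (12,12,12,0); (12,12,12,0); (6,6,6,0); (27,27,0,0); (0,0,0,0)];
 [:: (9,9,9,0); (10,10,10,0); (2,2,2,0); (4,4,4,0); (2,2,2,0)];
 [:: (4,4,4,0); (3,3,3,0); (-1,-1,-1,0); (6,6,6,0)];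
 [:: (-4,-4,-4,0); (0,0,0,0); (-2,-2,-2,0)];
 [:: (-2,-2,-2,0); (-4,-4,-4,0)];
 [:: (-3,-3,-3,0)]];
 [:: [:: (79,81,0,0); (70,81,0,0); (54,76,0,0); (27,68,2,0); (36,63,9,0); (12,12,0,0); (-1,-1,0,0); (-27,-27,0,0); (-5,-5,0,0); (15,15,0,0)];
 [:: (73,77,0,0); (45,68,0,0); (29,57,6,0); (18,62,13,0); (53,53,0,0); (30,30,0,0); (-25,-25,0,0); (-45,-45,0,0); (32,32,0,0)];
 [:: (17,39,8,0); (18,46,10,0); (10,39,17,0); (35,35,0,0); (51,51,0,0); (29,29,0,0); (-28,-28,0,0); (8,8,0,0)];
 [:: (11,32,22,0); (-7,32,18,0); (8,8,0,0); (8,8,0,0); (60,60,0,0); (12,12,0,0); (-15,-15,0,0)];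
 [:: (-11,16,16,0); (-10,-10,0,0); (-14,-14,0,0); (-7,-7,0,0); (68,68,0,0); (-22,-22,0,0)];
 [:: (14,14,14,0); (10,10,10,0); (6,6,6,0); (2,2,2,0); (0,0,0,0)];
 [:: (11,11,12,0); (2,2,2,0); (0,0,0,0); (3,3,3,0)];
 [:: (-3,-3,-2,0); (0,0,0,0); (-1,-1,-1,0)];
 [:: (-2,-2,0,0); (-1,-1,-1,0)];
 [:: (-2,-2,-1,0)]];
 [:: [:: (70,71,0,0); (69,71,0,0); (55,71,0,0); (32,71,0,0); (30,70,2,0); (29,45,8,0); (2,2,0,0); (-47,-47,0,0); (-9,-9,0,0); (14,14,0,0)];
 [:: (73,74,0,0); (47,71,0,0); (32,64,3,0); (16,59,3,0); (7,77,8,0); (41,41,0,0); (2,2,0,0); (-44,-44,0,0); (33,33,0,0)];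
 [:: (34,64,0,0); (22,52,2,0); (22,53,6,0); (11,43,3,0); (39,39,0,0); (28,28,0,0); (-35,-35,0,0); (14,14,0,0)];
 [:: (12,38,9,0); (-3,32,4,0); (-6,32,19,0); (22,22,0,0); (58,58,0,0); (2,2,0,0); (2,2,0,0)];
 [:: (-2,25,25,0); (-2,22,22,0); (-5,-5,0,0); (1,1,0,0); (63,63,0,0); (-14,-14,0,0)];
 [:: (-5,19,22,0); (-23,-23,0,0); (-13,-13,0,0); (28,28,0,0); (-24,-24,0,0)];
 [:: (16,16,17,0); (2,2,2,0); (-2,-2,-1,0); (0,0,2,0)];
 [:: (-11,-11,-5,0); (0,0,1,0); (-5,-5,-3,0)];
 [:: (-1,-1,1,0); (-2,-2,1,0)];
 [:: (-2,-2,-1,0)]];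
 [:: [:: (58,58,-17,0); (64,64,0,0); (25,57,0,0); (31,58,0,0); (15,57,1,0); (29,57,1,0); (33,59,9,0); (-11,-11,0,0); (-11,-11,0,0); (13,13,0,0)];
 [:: (64,65,-1,0); (58,64,0,0); (40,58,0,0); (21,58,0,0); (-15,59,3,0); (4,68,12,0); (62,62,0,0); (-46,-46,0,0); (20,20,0,0)];
 [:: (28,64,0,0); (21,58,0,0); (24,58,1,0); (29,59,4,0); (4,57,1,0); (37,37,0,0); (-21,-21,0,0); (13,13,0,0)];
 [:: (21,57,2,0); (26,58,1,0); (25,58,3,0); (15,33,19,0); (-6,-6,0,0); (20,20,0,0); (1,1,0,0)];
 [:: (10,45,3,0); (-2,22,10,0); (9,27,25,0); (-5,-5,0,0); (60,60,0,0); (8,8,0,0)];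
 [:: (4,30,30,0); (-10,26,26,0); (-13,-13,0,0); (36,36,0,0); (-9,-9,0,0)];
 [:: (-9,13,22,0); (-17,-17,0,0); (-35,-35,0,0); (-21,-21,0,0)];
 [:: (-7,-7,-4,0); (1,1,2,0); (-7,-7,-4,0)];
 [:: (-6,-6,-2,0); (-1,-1,3,0)];
 [:: (-1,-1,0,0)]];
 [:: [:: (51,51,-23,0); (54,54,-23,0); (42,55,-18,0); (14,52,-5,0); (-11,49,0,0); (9,48,0,0); (35,45,0,0); (47,47,0,0); (-8,-8,0,0); (-2,-2,0,0)];
 [:: (54,54,-19,0); (52,53,-5,0); (43,52,0,0); (30,52,0,0); (18,52,0,0); (-8,50,2,0); (-3,44,6,0); (5,5,0,0); (8,8,0,0)];
 [:: (44,54,-6,0); (32,52,0,0); (27,52,0,0); (25,52,0,0); (7,50,2,0); (3,46,4,0); (12,12,0,0); (3,3,0,0)];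
 [:: (22,52,-2,0); (16,52,0,0); (19,52,0,0); (28,49,2,0); (6,48,4,0); (18,18,0,0); (4,4,0,0)];
 [:: (11,52,0,0); (8,52,0,0); (17,49,2,0); (14,27,18,0); (15,15,0,0); (4,4,0,0)];
 [:: (17,50,2,0); (6,37,21,0); (2,22,22,0); (6,6,0,0); (21,21,0,0)];
 [:: (9,27,33,0); (-19,22,23,0); (-15,-15,0,0); (2,2,0,0)];
 [:: (-14,-3,30,0); (-29,-29,0,0); (-36,-36,1,0)];
 [:: (-5,-5,1,0); (0,0,1,0)];
 [:: (-2,-2,-1,0)]];
 [:: [:: (42,42,-23,0); (46,46,-23,0); (22,49,-23,0); (6,47,-23,0); (-11,44,-21,0); (27,42,-15,0); (34,41,-13,0); (33,39,-9,0); (25,36,0,0); (15,15,0,0)];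
 [:: (51,51,-23,0); (46,52,-23,0); (34,51,-23,0); (29,46,-16,0); (24,44,-4,0); (10,44,0,0); (6,41,6,0); (10,37,5,0); (12,12,-2,0)];
 [:: (39,49,-23,0); (34,50,-23,0); (26,46,-16,0); (27,44,-4,0); (16,44,0,0); (6,40,6,0); (8,37,6,0); (9,9,-2,0)];
 [:: (28,48,-23,0); (12,46,-16,0); (18,44,-4,0); (21,44,0,0); (15,40,6,0); (16,37,6,0); (10,10,-2,0)];
 [:: (9,45,-11,0); (0,44,-3,0); (13,43,0,0); (23,40,6,0); (21,37,6,0); (10,10,-3,0)];
 [:: (-14,44,-1,0); (9,44,0,0); (19,41,6,0); (6,35,9,0); (10,10,-1,0)];
 [:: (-9,39,2,0); (0,39,6,0); (-6,27,15,0); (-5,-5,0,0)];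
 [:: (-9,30,14,0); (-22,19,19,0); (-15,-15,0,0)];
 [:: (-19,7,16,0); (-29,-29,4,0)];
 [:: (4,4,5,0)]];
 [:: [::];
 [:: (0,0,0,0); (0,0,0,0); (0,0,0,0); (0,0,0,0); (0,0,0,0); (0,0,0,0); (0,0,0,0); (0,0,0,0); (0,0,0,0)];
 [:: (0,0,0,0); (0,0,0,0); (0,0,0,0); (0,0,0,0); (0,0,0,0); (0,0,0,0); (0,0,0,0); (0,0,0,0)];
 [:: (0,0,0,0); (0,0,0,0); (0,0,0,0); (0,0,0,0); (0,0,0,0); (0,0,0,0); (0,0,0,0)];
 [:: (0,0,0,0); (0,0,0,0); (0,0,0,0); (0,0,0,0); (0,0,0,0); (0,0,0,0)];
 [:: (0,0,0,0); (0,0,0,0); (0,0,0,0); (0,0,0,0); (0,0,0,0)];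
 [:: (0,0,0,0); (0,0,0,0); (0,0,0,0); (0,0,0,0)];
 [:: (0,0,0,0); (0,0,0,0); (0,0,0,0)];
 [:: (0,0,0,0); (0,0,0,0)];
 [:: (0,0,0,0)]]].

Local Close Scope Z_scope.

(** * Lower bounds for one pair of positions *)

Definition one : Z := 200.
Definition npos := 36.

(* [psi l] is the share of a vertex matched to a later partner of level [l], i.e.
   ranked after exactly [l] of the 36 positions, two of which lie in each bucket. *)
Definition psi (l : nat) : Z := nth Z0 psi_table (if Nat.leb npos l then 17 else l./2).
(** Lower bound for the share of a vertex at position [q] with a partner of level at most [l]; a
    partner of level at most [q] is ranked no later than the vertex. *)
Definition gain (q l : nat) : Z := if Nat.leb l q then Z.sub one (psi q) else psi l.

Definition pot_table f := match f with Same => pot_same | Below => pot_below | Above => pot_above end.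

(* Potentials [(P, Q, L, pay)] for a lower vertex at [x] and a higher vertex at
   [y] with last choice at level [b], constant on blocks of size 4 in [b],
   [x - b] and [y - b].  The higher vertex is credited with [P] or [Q] when its
   best accepted neighbour, of level at most or above [y], is not its last
   choice, with [L] when it is, and with 0 when it accepts nothing; [pay] is
   charged to the lower vertex when it would accept nothing at [y]. *)
Definition pot f b x y : Z * Z * Z * Z :=
  let k := b./2./2 in let o := (k.+1 * 4 - b)%N in
  let i := (x + o)%N./2./2 in
  nth (Z0, Z0, Z0, Z0) (nth [::] (nth [::] (pot_table f) k) i) ((y + o)%N./2./2 - i).

Definition min3 a b c := Z.min a (Z.min b c).

(* The next four functions bound the total share minus the potential of the
   higher vertex, minimised over the states of the latter, when the best
   accepted neighbour of the lower vertex has level at most [x], has level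
   [m > x], is the last choice (of level [a]), or does not exist. *)
Definition passive_value f b x y : Z :=
  let: (P, Q, L, _) := pot f b x y in
  Z.add (Z.sub one (psi x)) (min3 (Z.sub (gain y b) (Z.max P Q)) (Z.opp L) 0).

(** The best accepted neighbour of the lower vertex is ranked after both positions. If that of the
    higher vertex is missing or ranked after [x], the two are matched together and share [one];
    otherwise they get at least [1 - psi y] and [psi m]. *)
Definition beyond b x y (P Q L : Z) (m : nat) : Z :=
  Z.min (min3 (Z.sub one Q) one (if Nat.ltb x b then Z.sub one L else one))
    (Z.add (Z.add (Z.sub one (psi y)) (psi m))
       (Z.min (Z.opp P) (if Nat.ltb x b then one else Z.opp L))).

Definition active_value f b x y : nat -> Z :=
  let: (P, Q, L, _) := pot f b x y in
  let g := gain y b in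
  let hurt := min3 (Z.sub g (Z.max P Q)) (Z.opp L) 0 in
  let safe := min3 (Z.sub g (Z.max P Q)) (Z.sub g L) 0 in
  let far := beyond b x y P Q L in
  fun m => if Nat.leb m y then Z.add (psi m) (if Nat.leb m b then hurt else safe) else far m.

Definition final_value f b x y : nat -> Z :=
  let: (P, Q, L, pay) := pot f b x y in
  let g := gain y b in
  let near := min3 (Z.sub g (Z.max P Q))
    (Z.sub (match f with Same => Z0 | Below => Z.min g (Z.max 0 pay) | Above => g end) L) 0 in
  let far := beyond b x y P Q L in
  fun a => if Nat.leb a y then Z.add (gain x a) near else far a.

Definition free_value f b x y : Z :=
  let: (P, Q, L, _) := pot f b x y in
  let o := Z.sub one (psi y) in
  Z.min (min3 (Z.sub o P) (Z.sub one Q) (Z.sub (if Nat.ltb x b then one else o) L)) one.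

Lemma lebE m n : Nat.leb m n = (m <= n).
Proof. by apply/idP/idP; lia. Qed.

Lemma ltbE m n : Nat.ltb m n = (m < n).
Proof. exact: lebE. Qed.

(** [psi] is constant from level 36 on, so finitely many pairs are checked. *)
Lemma psi_le l l' : l <= l' -> (psi l' <= psi l)%R.
Proof.
have psi_min k : psi k = psi (minn npos k).
  by rewrite /psi !lebE; case: (leqP npos k) => h; rewrite ?leqnn // leqNgt h.
have chk : all (fun k => all (fun k' => Z.leb (psi k') (psi k)) (iota k (npos.+1 - k))) (iota 0 npos.+1).
  by vm_compute.
move=> ll'; rewrite (psi_min l) (psi_min l').
have le1 : minn npos l <= minn npos l' by rewrite leq_min geq_minl (leq_trans (geq_minr _ _)).
have le2 : minn npos l' <= npos := geq_minl _ _.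
move/allP: chk => /(_ (minn npos l)); rewrite mem_iota ltnS geq_minl => /(_ isT)/allP/(_ (minn npos l')).
by rewrite mem_iota le1 subnKC ?ltnS ?le2 ?(leq_trans (geq_minl _ _)) //; apply.
Qed.

Lemma psi_ge0 l : (0 <= psi l)%R.
Proof. by apply: le_trans (psi_le (leq_maxl l npos)); rewrite /psi lebE leq_maxr. Qed.

Lemma psi_half l : (psi l + psi l <= one)%R.
Proof. by have -> : one = (psi 0 + psi 0)%R by []; have := psi_le (leq0n l); lia. Qed.

Lemma gainE q l : gain q l = if l <= q then (one - psi q)%R else psi l.
Proof. by rewrite /gain lebE. Qed.

(** A share earned with an earlier partner is at least 1/2, one earned with a later partner at most
    1/2. *)
Lemma gain_le q l l' : l <= l' -> (gain q l' <= gain q l)%R.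
Proof.
move=> ll'; rewrite !gainE; have := psi_half q; have := psi_half l'; have := psi_le ll'.
by case: ifP; case: ifP; lia.
Qed.

(* The best accepted neighbour has level [m] and the last choice is a second
   accepted neighbour; or it is the last choice; or there is none. *)
Inductive state := Backed of nat | Final | Free.

Definition level (c : nat) (s : state) : option nat :=
  match s with Backed m => Some m | Final => Some c | Free => None end.

Definition is_free s := if s is Free then true else false.
Definition is_backed s := if s is Backed _ then true else false.

Definition lower_value f b x y a s : Z :=
  match s with
  | Backed m => if m <= x then passive_value f b x y else active_value f b x y m
  | Final => final_value f b x y a
  | Free => free_value f b x y
  end.
Definition upper_value f b x y s : Z :=
  let: (P, Q, L, _) := pot f b x y in
  match s with Backed m => if m <= y then P else Q | Final => L | Free => 0%R end.
Definition pay_value f b x y s : Z := if is_free s then Z.max 0 (pot f b x y).2 else 0%R.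

(* The lower vertex, at position [x], has state [sx], share [gx] and last choice
   of level [a]; the higher one, at [y], has [sy], [gy] and [b]; [s] is the state
   that the lower vertex would have at position [y]. *)
Record cell_ok f (a b x y : nat) (sx sy s : state) (gx gy : Z) : Prop := CellOk {
  cell_ge0 : (0 <= gx)%R /\ (0 <= gy)%R;
  cell_both : (forall m, level a sx = Some m -> y < m) ->
     (forall m, level b sy = Some m -> x < m) -> (one <= gx + gy)%R;
  cell_low : forall m, level a sx = Some m -> (gain x m <= gx)%R;
  cell_high : forall m', level b sy = Some m' -> (gain y m' <= gy)%R \/
     [/\ exists2 m, level a sx = Some m & m <= m',
         is_backed sy -> (gain y b <= gy)%R
       & sx = Final -> sy = Final -> f <> Same -> is_free s] }.

Local Arguments Z.sub : simpl never.
Local Arguments Z.add : simpl never.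
Local Arguments one : simpl never.
Local Arguments beyond : simpl never.

(** The decoupling inequality, by cases on both states. The delicate case has both states [Final]
    and a hurt higher vertex, so that [a <= b]: this contradicts [Above], and in [Below] it forces
    [s] to be free, so that the payment covers the loss. *)
Lemma cell_bound f a b x y sx sy s gx gy : x < y -> (f = Above -> b < a) ->
  (forall m, sy = Backed m -> m <= b) -> cell_ok f a b x y sx sy s gx gy ->
  (lower_value f b x y a sx + upper_value f b x y sy - pay_value f b x y s <= gx + gy)%R.
Proof.
move=> ltxy fa sy_le [[gx0 gy0] both low high].
rewrite /lower_value /upper_value /pay_value /passive_value /active_value /final_value /free_value.
have psi_mono := psi_le.
have [psi0 psih] := (psi_ge0, psi_half).
case: (pot f b x y) => [[[P Q] L] p] /=; rewrite !lebE ?ltbE.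
(* The level [b] of the last choice replaces the smaller level of the best neighbour; the share can
   then fall below [gain y b] only in state [Final]. *)
have high' m' : level b sy = Some m' -> (gain y b <= gy)%R \/
     [/\ exists2 m, level a sx = Some m & m <= m', sy = Final & sx = Final -> f <> Same -> is_free s].
  move=> E; have lem : m' <= b.
    by move: sy_le E; clear; case: sy => [k h [<-]|_ [<-]|//]; [apply: h|].
  have := gain_le y lem; case: (high _ E) => [|[? hb hf]]; first by left; lia.
  case: sy E hb hf {sy_le both high} => [k||] //= _ hb hf; first by left; apply: hb.
  by right; split=> // sF; apply: hf.
have [c cE] : exists c, c = match sy with
    Backed m => if (m <= y)%N then P else Q | Final => L | Free => 0%R end by eexists.
rewrite -cE.
rewrite /min3; have := gainE y b; set g := gain y b; move=> gE.
have gy_backed m' : sy = Backed m' -> (g <= gy)%R.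
  by move=> E; have := high' m'; rewrite E => /(_ erefl)[//|[]].
have gy_passive m' : level b sy = Some m' -> m' <= y ->
  (forall m, level a sx = Some m -> m' < m) -> (one - psi y <= gy)%R.
  move=> E le nh; have [|[[m Em lem] _ _]] := high _ E; last by have := nh _ Em; lia.
  by rewrite gainE le.
have psiy := psi0 y.
have far m : level a sx = Some m -> y < m ->
   (beyond b x y P Q L m + c <= gx + gy)%R.
  move=> Em ltym; have psim := psi_mono _ _ (ltnW ltym).
  have gxm := low _ Em; rewrite gainE leqNgt (ltn_trans ltxy ltym) /= in gxm.
  have both' : (forall m', level b sy = Some m' -> x < m') -> (one <= gx + gy)%R.
    by apply: both => k; rewrite Em => -[<-].
  have nh m' : m' <= x -> forall k, level a sx = Some k -> m' < k.
    by move=> le k; rewrite Em => -[<-]; lia.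
  rewrite /beyond !ltbE /min3.
  case: sy cE {sy_le high high' gy_backed} both both' gy_passive => [m'||] cE _ both' pas; rewrite cE.
  - have [ltx|lex] := ltnP x m'.
      by have := both' (fun _ E => ltac:(case: E => <-; exact ltx)); case: ifP; case: ifP; lia.
    have := pas m' erefl ltac:(lia) (nh _ lex); have -> : m' <= y by lia.
    by case: ifP; lia.
  - case: (ltnP x b) => [ltx|lex].
      by have := both' (fun _ E => ltac:(case: E => <-; exact ltx)); lia.
    by have := pas b erefl ltac:(lia) (nh _ lex); lia.
  - by have := both' (fun _ E => ltac:(discriminate E)); case: ifP; lia.
case: sx low both high high' gy_passive far => [m||] low both high high' pas far; rewrite ?lebE ?ltbE.
- have gxm := low m erefl; rewrite gainE in gxm.
  case: (leqP m x) => [lemx|ltxm].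
    rewrite lemx in gxm.
    case: sy cE {sy_le pas far both} gy_backed high high' => [m'||] cE gb high high'; rewrite cE.
    + by have := gb m' erefl; case: ifP; case: (is_free s); lia.
    + by case: (is_free s); lia.
    + by case: (is_free s); lia.
  rewrite leqNgt ltxm /= in gxm.
  case: (leqP m y) => [lemy|ltym]; last first.
    by have := far m erefl ltym; case: (is_free s); lia.
  case: sy cE {sy_le pas far both} gy_backed high high' => [m'||] cE gb high high'; rewrite cE.
  + by have := gb m' erefl; do 2!case: ifP => _; case: (is_free s); lia.
  + case: (leqP m b) => [lemb|ltbm]; first by case: (is_free s); lia.
    have [hg|[[k [<-] lek] _ _]] := high' b erefl; last by lia.
    by case: (is_free s); lia.
  + by case: ifP; case: (is_free s); lia.
- have gxa := low a erefl.
  case: (leqP a y) => [leay|ltya]; last by have := far a erefl ltya; case: (is_free s); lia.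
  case: sy cE {sy_le pas far both} gy_backed high high' => [m'||] cE gb high high'; rewrite cE.
  + by have := gb m' erefl; case: ifP => _; case: (is_free s); case: (f); lia.
  + have [hg|[[k [<-] leab] _ hf]] := high' b erefl.
      by case: (is_free s); case: (f); lia.
    case: f fa hf {high high'} => fa hf; first by case: (is_free s); lia.
      by rewrite hf //; lia.
    by have := fa erefl; lia.
  + by case: (is_free s); case: (f); lia.
- have {}both : (forall m', level b sy = Some m' -> x < m') -> (one <= gx + gy)%R.
    by apply: both.
  have nh m' : forall k, level a Free = Some k -> m' < k by [].
  case: sy cE {sy_le far high high' gy_backed low} both pas => [m'||] cE both pas; rewrite cE.
  + have [ltx|lex] := ltnP x m'.
      have := both (fun _ E => ltac:(case: E => <-; exact ltx)).
      by case: ifP; case: ifP; case: (is_free s); lia.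
    have := pas m' erefl ltac:(lia) (nh _); have -> : m' <= y by lia.
    by case: ifP; case: (is_free s); lia.
  + case: (ltnP x b) => [ltx|lex].
      by have := both (fun _ E => ltac:(case: E => <-; exact ltx)); case: (is_free s); lia.
    by have := pas b erefl ltac:(lia) (nh _); case: (is_free s); lia.
  + by have := both (fun _ E => ltac:(discriminate E)); case: ifP; case: (is_free s); lia.
Qed.

(** * The finite minimisation, position by position *)

(** The two vertices have distinct residues, and a residue determines the parity of the position;
    hence only opposite parities meet. *)
Definition after x := [seq y <- iota 0 npos | Nat.ltb x y && odd (y + x)].
Definition before y := [seq x <- iota 0 npos | Nat.ltb x y && odd (y + x)].

Definition sumZ (s : seq Z) : Z := foldr Z.add Z0 s.
(* Larger than every sum of values over a line. *)
Definition infty : Z := 1000000.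

(** Entry [k] covers the first [k] elements. The list scanned in [mkline] starts at level 1, so
    entry [a] covers the levels up to [a]; level 0 never exceeds [x]. *)
Fixpoint scanmin (acc : Z) (s : seq Z) : seq Z :=
  acc :: if s is z :: t then scanmin (Z.min acc z) t else [::].

(* Sums over all positions of the other vertex, as the lower vertex at [x] (for
   every level [m] of the best accepted neighbour or [a] of the last choice) and
   as the higher one.  Entry [a] of [lower_active] is a minimum over [m <= a]. *)
Record line := Line { lower_passive : Z; lower_free : Z; upper_passive : Z; upper_active : Z;
  upper_final : Z; lower_active : seq Z; lower_final : seq Z }.

Definition mkline f b x : line :=
  let ys := after x in
  let actives := [seq active_value f b x y | y <- ys] in
  let lasts := [seq final_value f b x y | y <- ys] in
  let pots := [seq pot f b x' x | x' <- before x] in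
  Line (sumZ [seq passive_value f b x y | y <- ys])
      (Z.sub (sumZ [seq free_value f b x y | y <- ys]) (sumZ [seq Z.max 0 q.2 | q <- pots]))
      (sumZ [seq q.1.1.1 | q <- pots]) (sumZ [seq q.1.1.2 | q <- pots])
      (sumZ [seq q.1.2 | q <- pots])
      (scanmin infty [seq (if Nat.leb m x then infty else sumZ [seq c m | c <- actives]) | m <- iota 1 npos])
      [seq sumZ [seq c a | c <- lasts] | a <- iota 0 npos.+1].

(** Minimum over the states of one vertex at one position: [r] is its line as the lower vertex, [r']
    its line as the higher one. A free vertex has no credit as the higher one. *)
Definition line_min a (r r' : line) : Z :=
  Z.min (min3 (Z.add (lower_passive r) (upper_passive r')) (lower_free r)
             (Z.add (nth Z0 (lower_active r) a) (upper_active r')))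
        (Z.add (nth Z0 (lower_final r) a) (upper_final r')).

Fixpoint side a (s s' : seq line) : Z :=
  if s is r :: t then
    if s' is r' :: t' then Z.add (line_min a r r') (side a t t') else Z0
  else Z0.

Definition table f := [seq [seq mkline f b x | x <- iota 0 npos] | b <- iota 0 npos.+1].
(* 0.56 of the [2 * 18 ^ 2] pairs of positions of opposite parity. *)
Definition target : Z := 72576.

(** A common last choice has one level for both vertices, whose sums then coincide. *)
Definition same_ok : bool :=
  let same := table Same in
  all (fun b => Z.leb target (Z.mul 2 (side b (nth [::] same b) (nth [::] same b))))
    (iota 0 npos.+1).

(** Exchanging the two vertices gives [a <= b]. At equal levels the regime is [Below] whichever
    vertex is the lower one. *)
Definition differ_ok : bool :=
  let below := table Below in let above := table Above in
  all (fun b => all (fun a =>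
      let rb := nth [::] below b in
      let ra := nth [::] (if Nat.eqb a b then below else above) a in
      Z.leb target (Z.add (side a rb ra) (side b ra rb)))
    (iota 0 b.+1)) (iota 0 npos.+1).

Lemma same_okT : same_ok.
Proof. by vm_compute. Qed.

Lemma differ_okT : differ_ok.
Proof. by vm_compute. Qed.

(** * Soundness of the finite minimisation *)

Section Soundness.
Local Open Scope ring_scope.

Lemma sumZE T (s : seq T) F : sumZ [seq F i | i <- s] = \sum_(i <- s) F i.
Proof. by elim: s => [|i s IH] /=; rewrite ?big_nil // big_cons IH. Qed.

Lemma nth_scanmin acc s i k : (i < size s)%N -> (i < k <= size s)%N ->
  Z.le (nth Z0 (scanmin acc s) k) (nth Z0 s i).
Proof.
have le_acc acc' s' k' : (k' <= size s')%N -> Z.le (nth Z0 (scanmin acc' s') k') acc'.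
  elim: s' acc' k' => [|z s' IH] acc' [|k'] //= ltk; try lia.
  by have := IH (Z.min acc' z) k' ltk; lia.
elim: s acc i k => [|z s IH] acc [|i] [|k] //= lti ltk.
  by have := le_acc (Z.min acc z) s k ltac:(lia); lia.
by apply: IH; lia.
Qed.

(** All terms depending on the state [s] of one vertex at [p]. The payments belong to pairs in which
    it is the lower vertex, at [x], and the other one is at [p]: they depend on the state it would
    have at [p]. *)
Definition line_total f b f' a p s : Z :=
  \sum_(y <- after p) lower_value f b p y a s + \sum_(x <- before p) upper_value f' a x p s
  - \sum_(x <- before p) pay_value f b x p s.

Lemma line_min_le f b f' a p s : (p < npos)%N -> (a <= npos)%N ->
  (forall m, s = Backed m -> (m <= a)%N) ->
  line_min a (mkline f b p) (mkline f' a p) <= line_total f b f' a p s.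
Proof.
move=> ltp lea s_le; rewrite /line_total /line_min /min3.
have pay0 : (if is_free s then \sum_(x <- before p) pay_value f b x p s = \sum_(x <- before p) Z.max 0 (pot f b x p).2
             else \sum_(x <- before p) pay_value f b x p s = 0).
  by case: (boolP (is_free s)) => h; [apply: eq_bigr | apply: big1] => x _; rewrite /pay_value ?h // (negPf h).
case: s s_le pay0 => [m /(_ m erefl) lem|_|_] pay0; rewrite [\sum_(x <- before p) pay_value _ _ _ _ _]pay0.
- case: (leqP m p) => [lemp|ltpm].
    have -> : \sum_(y <- after p) lower_value f b p y a (Backed m) = lower_passive (mkline f b p).
      by rewrite /= sumZE; apply: eq_bigr => y _; rewrite /lower_value lemp.
    have -> : \sum_(x <- before p) upper_value f' a x p (Backed m) = upper_passive (mkline f' a p).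
      by rewrite /= -map_comp sumZE; apply: eq_bigr => x _; rewrite /upper_value lemp /=; case: pot => [[[]]].
    by lia.
  have -> : \sum_(x <- before p) upper_value f' a x p (Backed m) = upper_active (mkline f' a p).
    by rewrite /= -map_comp sumZE; apply: eq_bigr => x _; rewrite /upper_value leqNgt ltpm /=; case: pot => [[[]]].
  have leact : Z.le (nth Z0 (lower_active (mkline f b p)) a)
      (\sum_(y <- after p) lower_value f b p y a (Backed m)).
    set F := fun m => if Nat.leb m p then infty else
      sumZ [seq c m | c <- [seq active_value f b p y | y <- after p]].
    have -> : lower_active (mkline f b p) = scanmin infty [seq F m | m <- iota 1 npos] by [].
    (* Level [m] is element [m.-1] of the list, which entry [a] covers because [m <= a]. *)
    have := @nth_scanmin infty [seq F m | m <- iota 1 npos] m.-1 a.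
    rewrite size_map size_iota => /(_ ltac:(lia) ltac:(lia)).
    rewrite (nth_map 0%N) ?size_iota; last by lia.
    rewrite nth_iota; last by lia.
    have -> : (1 + m.-1)%N = m by lia.
    have -> : F m = sumZ [seq c m | c <- [seq active_value f b p y | y <- after p]].
      by rewrite /F lebE leqNgt ltpm.
    move=> /Z.le_trans; apply.
    rewrite -map_comp sumZE; apply: Z.eq_le_incl; apply: eq_bigr => y _.
    by rewrite /lower_value leqNgt ltpm.
  by lia.
- have -> : \sum_(x <- before p) upper_value f' a x p Final = upper_final (mkline f' a p).
    by rewrite /= -map_comp sumZE; apply: eq_bigr => x _; rewrite /upper_value /=; case: pot => [[[]]].
  have -> : \sum_(y <- after p) lower_value f b p y a Final = nth Z0 (lower_final (mkline f b p)) a.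
    have -> : lower_final (mkline f b p) = [seq sumZ [seq c a | c <-
      [seq final_value f b p y | y <- after p]] | a <- iota 0 npos.+1] by [].
    rewrite (nth_map 0%N) ?size_iota; last by lia.
    by rewrite nth_iota ?add0n -?map_comp ?sumZE //; lia.
  by lia.
- have -> : \sum_(x <- before p) upper_value f' a x p Free = 0.
    by apply: big1 => x _; rewrite /upper_value; case: pot => [[[]]].
  have -> : lower_free (mkline f b p) = (\sum_(y <- after p) lower_value f b p y a Free
       - \sum_(x <- before p) Z.max 0 (pot f b x p).2)%R.
    by rewrite /= -map_comp !sumZE.
  by lia.
Qed.

Lemma sideE (T : eqType) a (s : seq T) F G :
  side a [seq F p | p <- s] [seq G p | p <- s] = \sum_(p <- s) line_min a (F p) (G p).
Proof. by elim: s => [|p s IH]; rewrite ?big_nil // big_cons -IH. Qed.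

Lemma side_table (fa fb : regime) a b : (a <= npos)%N -> (b <= npos)%N ->
  side a (nth [::] (table fb) b) (nth [::] (table fa) a) =
  \sum_(p <- iota 0 npos) line_min a (mkline fb b p) (mkline fa a p).
Proof.
move=> lea leb; rewrite /table !(nth_map 0%N) ?size_iota ?ltnS //.
by rewrite !nth_iota ?ltnS // !add0n sideE.
Qed.

Lemma same_bound b : (b <= npos)%N ->
  target <= \sum_(p <- iota 0 npos) line_min b (mkline Same b p) (mkline Same b p)
          + \sum_(p <- iota 0 npos) line_min b (mkline Same b p) (mkline Same b p).
Proof.
move=> leb; have := same_okT; rewrite /same_ok => /allP/(_ b).
by rewrite mem_iota ltnS side_table // => /(_ leb); lia.
Qed.

Lemma differ_bound a b : (a <= b <= npos)%N ->
  let fa := if a == b then Below else Above in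
  target <= \sum_(p <- iota 0 npos) line_min a (mkline Below b p) (mkline fa a p)
          + \sum_(p <- iota 0 npos) line_min b (mkline fa a p) (mkline Below b p).
Proof.
case/andP=> leab leb; have := differ_okT; rewrite /differ_ok => /allP/(_ b).
rewrite mem_iota ltnS => /(_ leb)/allP/(_ a); rewrite mem_iota ltnS => /(_ leab).
have -> : Nat.eqb a b = (a == b) by apply/idP/idP; lia.
have -> : (if a == b then table Below else table Above) = table (if a == b then Below else Above).
  by case: eqP.
by rewrite !side_table // ?(leq_trans leab) //; lia.
Qed.

Lemma mem_after x y : (y \in after x) = [&& x < y, y < npos & odd (y + x)]%N.
Proof. by rewrite mem_filter mem_iota ltbE add0n -andbA; congr andb; apply: andbC. Qed.

Lemma exchange_after (W : nat -> nat -> Z) :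
  \sum_(y <- iota 0 npos) \sum_(x <- before y) W x y
  = \sum_(x <- iota 0 npos) \sum_(y <- after x) W x y.
Proof.
under eq_bigr do rewrite big_filter big_mkcond.
rewrite exchange_big /=; apply: eq_bigr => x _.
by rewrite big_filter [RHS]big_mkcond.
Qed.

Lemma split_opposite (W : nat -> nat -> Z) :
  \sum_(p <- iota 0 npos) \sum_(q <- iota 0 npos | odd (q + p)) W p q
  = \sum_(x <- iota 0 npos) \sum_(y <- after x) (W x y + W y x).
Proof.
under [RHS]eq_bigr do rewrite big_split.
rewrite big_split /= -(exchange_after (fun x y => W y x)) -big_split /=.
apply: eq_bigr => p _; rewrite /after /before !big_filter big_mkcond [X in _ = X + _]big_mkcond.
rewrite [X in _ = _ + X]big_mkcond -big_split /=; apply: eq_bigr => q _.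
rewrite !ltbE [(p + q)%N]addnC; case: ltngtP => [lt|lt|->]; rewrite ?addr0 ?add0r //.
by rewrite addnn odd_double.
Qed.

Section Game.
Variables (f f' : regime) (a b : nat) (su sv : nat -> state) (gu gv : nat -> nat -> Z).
Hypotheses (fb : f = Above -> (b < a)%N) (fa : f' = Above -> (a < b)%N).
Hypotheses (lea : (a <= npos)%N) (leb : (b <= npos)%N).
Hypotheses (su_le : forall p m, su p = Backed m -> (m <= a)%N)
           (sv_le : forall p m, sv p = Backed m -> (m <= b)%N).
Hypothesis u_low : forall x y, (x < y)%N -> (y < npos)%N -> odd (y + x) ->
  cell_ok f a b x y (su x) (sv y) (su y) (gu x y) (gv x y).
Hypothesis v_low : forall x y, (x < y)%N -> (y < npos)%N -> odd (y + x) ->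
  cell_ok f' b a x y (sv x) (su y) (sv y) (gv y x) (gu y x).

(** The line totals are regrouped into pairs of positions, where [cell_bound] applies once for each
    choice of the lower vertex. *)
Lemma game_sum :
  \sum_(p <- iota 0 npos) line_min a (mkline f b p) (mkline f' a p)
  + \sum_(p <- iota 0 npos) line_min b (mkline f' a p) (mkline f b p)
  <= \sum_(p <- iota 0 npos) \sum_(q <- iota 0 npos | odd (q + p)) (gu p q + gv p q).
Proof.
have le1 : \sum_(p <- iota 0 npos) line_min a (mkline f b p) (mkline f' a p)
    <= \sum_(p <- iota 0 npos) line_total f b f' a p (su p).
  rewrite big_seq [X in _ <= X]big_seq; apply: ler_sum => p; rewrite mem_iota => /andP[_ ltp].
  exact: line_min_le (su_le (p := p)).
have le2 : \sum_(p <- iota 0 npos) line_min b (mkline f' a p) (mkline f b p)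
    <= \sum_(p <- iota 0 npos) line_total f' a f b p (sv p).
  rewrite big_seq [X in _ <= X]big_seq; apply: ler_sum => p; rewrite mem_iota => /andP[_ ltp].
  exact: line_min_le (sv_le (p := p)).
apply: le_trans (lerD le1 le2) _; rewrite /line_total !sumrB !big_split /= !exchange_after.
rewrite split_opposite; set Ru := (X in X + _ - _ + _); set Cu := (X in _ + X - _ + _).
set Pu := (X in _ + _ - X + _); set Rv := (X in _ - _ + (X + _ - _)).
set Cv := (X in _ - _ + (_ + X - _)); set Pv := (X in _ - _ + (_ + _ - X)).
(* The values of one vertex as the lower one meet the potentials of the other as the higher one. *)
have -> : Ru + Cu - Pu + (Rv + Cv - Pv) = (Ru + Cv - Pu) + (Rv + Cu - Pv) by lia.
rewrite -!big_split -!sumrB -big_split /=; apply: ler_sum => x _.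
rewrite -!big_split -!sumrB -big_split /= big_seq [leRHS]big_seq; apply: ler_sum => y.
rewrite mem_after => /and3P[ltxy lty oddxy]; apply: lerD.
  by apply: cell_bound (u_low ltxy lty oddxy); rewrite // => m /sv_le.
by rewrite [leRHS]addrC; apply: cell_bound (v_low ltxy lty oddxy); rewrite // => m /su_le.
Qed.

End Game.

End Soundness.

(** * Shares of vertices and levels of ranks *)

(** [bk] sends a rank to its bucket. Bucket [j] holds the positions [2j] and [2j + 1], hence the
    doubling. *)
Definition vertex_gain (V : finType) (bk : nat -> nat) (x : V -> nat) (mu : V -> V) (w : V) : Z :=
  if mu w == w then 0%R
  else if x w < x (mu w) then psi (bk (x (mu w))).*2 else (one - psi (bk (x w)).*2)%R.

Lemma psi_pos q : q < npos -> psi q./2.*2 = psi q.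
Proof.
move=> ltq; have leq2 : q./2.*2 <= q by lia.
by rewrite /psi !lebE leqNgt (leq_ltn_trans leq2 ltq) leqNgt ltq doubleK.
Qed.

Section Levels.
Variable z : nat -> nat.
Hypothesis z_mono : forall p q, p < q -> q < npos -> z p < z q.

(** As [z] increases, this counts the positions ranked strictly before [t]. *)
Definition lev (t : nat) : nat := find (fun p => t <= z p) (iota 0 npos).

Lemma lev_le t : lev t <= npos.
Proof. by rewrite -[X in _ <= X](size_iota 0) find_size. Qed.

Lemma lt_lev p t : p < npos -> (p < lev t) = (z p < t).
Proof.
move=> ltp; apply/idP/idP => [lt|].
  by have := before_find 0 lt; rewrite nth_iota // add0n ltnNge => ->.
apply: contraTT; rewrite -!leqNgt => lel.
have ltl : lev t < npos := leq_ltn_trans lel ltp.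
have : has (fun p => t <= z p) (iota 0 npos) by rewrite has_find size_iota.
move/(nth_find 0); rewrite nth_iota // add0n => /leq_trans; apply.
by move: lel; rewrite leq_eqVlt => /orP[/eqP<- //|lt]; apply/ltnW/z_mono.
Qed.

Lemma lev_mono s t : s <= t -> lev s <= lev t.
Proof.
move=> le; rewrite leqNgt; apply/negP => lt.
have ltn := leq_trans lt (lev_le s).
by move: lt; rewrite lt_lev // => /leq_trans/(_ le); rewrite -lt_lev // ltnn.
Qed.

(** All positions of earlier buckets are ranked before [t]. As [psi] is nonincreasing, reading it at
    levels instead of buckets can only lower a share. *)
Lemma lev_bucket (bk : nat -> nat) t : (forall s t, s <= t -> bk s <= bk t) ->
  (forall p, p < npos -> bk (z p) = p./2) -> (bk t).*2 <= npos -> (bk t).*2 <= lev t.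
Proof.
move=> bk_mono bk_z le; rewrite leqNgt; apply/negP => lt.
have ltl := leq_trans lt le.
have := ltnn (lev t); rewrite lt_lev // => /negbT; rewrite -leqNgt => /bk_mono.
by rewrite bk_z // => le2; move: lt le2; clear; lia.
Qed.

End Levels.
(* Closing tactics would unfold [find] over the 36 positions. *)
Opaque lev.

(** * From stable matchings to states of the two vertices *)

Section Semantics.
Variables (V : finType) (e : rel V).
Hypothesis e_sym : symmetric e.
Variables (u v : V) (neq_uv : u != v) (euv : e u v).
Variables (mu0 : V -> V) (k : V -> nat) (z bk : nat -> nat).
Hypothesis z_mono : forall p q, p < q -> q < npos -> z p < z q.
Hypothesis bk_mono : forall s t, s <= t -> bk s <= bk t.
Hypothesis bk_z : forall p, p < npos -> bk (z p) = p./2.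
Hypothesis k_bk : forall w, (bk (k w)).*2 <= npos.

(** This is [accepts] for [y] at position [p]. The position of the other vertex does not enter, so a
    state is a function of one position. *)
Definition acc_at (y : V) (p : nat) (w : V) : bool :=
  [&& e y w, off u v w & (mu0 w == w) || (z p < k (mu0 w))].

(** Take the neighbour whose [mu0] partner is ranked last; [T] puts neighbours unmatched in [mu0]
    above every rank. *)
Lemma last_choice y : exists c, forall p w, acc_at y p w -> acc_at y p c.
Proof.
have [w0 /andP[ew0 ow0]|none] := pickP (fun w => e y w && off u v w); last first.
  by exists y => p w /and3P[ew ow _]; have := none w; rewrite ew ow.
pose T w := if mu0 w == w then (\max_w k w).+1 else k (mu0 w).
have leT w : mu0 w != w -> T w <= \max_w k w by rewrite /T => /negPf->; exact: leq_bigmax.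
have [c /andP[ec oc] maxc] := arg_maxnP T (i0 := w0) (P := fun w => e y w && off u v w)
  (introT andP (conj ew0 ow0)).
exists c => p w /and3P[ew ow accw]; rewrite /acc_at ec oc /=.
have := maxc w; rewrite ew ow => /(_ isT); have [//|Nc] := eqVneq (mu0 c) c.
have [w0E|Nw] := eqVneq (mu0 w) w.
  by move=> leTT; have := leq_trans leTT (leT c Nc); rewrite /T w0E eqxx ltnn.
move: accw; rewrite (negPf Nw) /T (negPf Nw) (negPf Nc) /=; exact: leq_trans.
Qed.

Definition state_at (y c : V) (p : nat) : state :=
  if [pick w | acc_at y p w] is Some w0 then
    let m := [arg min_(w < w0 | acc_at y p w) k w] in
    if m == c then Final else Backed (lev z (k m))
  else Free.

Variant state_spec (y c : V) (p : nat) : state -> Type :=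
  | StateFree of (forall w, ~~ acc_at y p w) : state_spec y c p Free
  | StateFinal of acc_at y p c & (forall w, acc_at y p w -> k c <= k w) : state_spec y c p Final
  | StateBacked m of acc_at y p m & (forall w, acc_at y p w -> k m <= k w) & m != c :
      state_spec y c p (Backed (lev z (k m))).

Lemma stateP y c p : state_spec y c p (state_at y c p).
Proof.
rewrite /state_at; case: pickP => [w0 acc0|none]; last by constructor=> w; rewrite none.
have [m accm minm] := arg_minnP k acc0.
by case: (eqVneq m c) => [E|Nm]; [constructor; rewrite -?E|constructor].
Qed.

Lemma stateP_level y c p : (forall p w, acc_at y p w -> acc_at y p c) ->
  (exists2 m, acc_at y p m /\ (forall w, acc_at y p w -> k m <= k w) &
     level (lev z (k c)) (state_at y c p) = Some (lev z (k m)))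
  \/ (forall w, ~~ acc_at y p w) /\ state_at y c p = Free.
Proof.
by move=> top; case: stateP => [none|acc min|m acc min N]; [right|left; exists c|left; exists m].
Qed.

Lemma state_le y c p m : (forall p w, acc_at y p w -> acc_at y p c) ->
  state_at y c p = Backed m -> m <= lev z (k c).
Proof.
move=> top; case: stateP => // m' acc min _ [<-]; apply: lev_mono => //.
exact/min/top/acc.
Qed.

Section Cell.
Variables (y y' : V) (p q : nat) (x : V -> nat) (mu : V -> V).
Hypotheses (yy' : pair_uv u v y y') (ltpq : p < q) (ltq : q < npos).
Hypotheses (xy : x y = z p) (xy' : x y' = z q).
Hypothesis x_off : forall w, off u v w -> x w = k w.
Hypotheses (x_inj : injective x) (st : stable e x mu).
Hypothesis st0 : stable (rel_off e u v) x mu0.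

Let lt_yy' : x y < x y'. Proof. by rewrite xy xy' z_mono. Qed.

Lemma acceptsE y0 r w : x y0 = z r -> accepts e x mu0 u v y0 w = acc_at y0 r w.
Proof.
move=> xy0; rewrite /accepts /acc_at xy0; congr [&& _, _ & _].
have [//|N0] := eqVneq (mu0 w) w; rewrite x_off //.
by case: st0 => _ /(_ w N0)/and3P[].
Qed.

Lemma vertex_gain_ge0 w : (0 <= vertex_gain bk x mu w)%R.
Proof.
rewrite /vertex_gain; case: ifP => // _; case: ifP => _; first exact: psi_ge0.
by have := psi_half (bk (x w)).*2; have := psi_ge0 (bk (x w)).*2; lia.
Qed.

(** Either the partner of [t] is later and [lev_bucket] compares its bucket with the level of [w],
    or the share is [1 - psi r], which dominates both values of [gain]. *)
Lemma gain_le_vertex t r w : x t = z r -> r < npos -> off u v w ->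
  mu t != t -> x (mu t) <= x w -> (gain r (lev z (k w)) <= vertex_gain bk x mu t)%R.
Proof.
move=> xt ltr ow Nt le; rewrite /vertex_gain (negPf Nt).
have [lt|ge] := ltnP (x t) (x (mu t)).
  have ltl : r < lev z (k w) by rewrite lt_lev // -xt -x_off // (leq_trans lt).
  rewrite gainE leqNgt ltl /=; apply: psi_le; apply: leq_trans (lev_bucket z_mono bk_mono bk_z (k_bk w)).
  by rewrite leq_double -x_off // bk_mono.
rewrite xt bk_z // psi_pos // gainE; case: ifP => // _.
by have := psi_half r; have := psi_half (lev z (k w)); lia.
Qed.

Lemma together_gain : mu y = y' -> (one <= vertex_gain bk x mu y + vertex_gain bk x mu y')%R.
Proof.
have [muK _ _] := st; have [_ _ N] := pair_uvP neq_uv yy' y.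
move=> E; have E' : mu y' = y by rewrite -E muK.
rewrite /vertex_gain E E' (negPf N) eq_sym (negPf N) lt_yy' ltnNge (ltnW lt_yy') /=; lia.
Qed.

(** The clauses come from [matched_together], [low_gets_accepted] and, for the higher vertex,
    [high_hurt_cause] with [high_gets_backup]. *)
Lemma cell_okP f c c' : (forall p w, acc_at y p w -> acc_at y p c) ->
  (forall p w, acc_at y' p w -> acc_at y' p c') -> (f <> Same -> c != c') ->
  cell_ok f (lev z (k c)) (lev z (k c')) p q (state_at y c p) (state_at y' c' q)
    (state_at y c q) (vertex_gain bk x mu y) (vertex_gain bk x mu y').
Proof.
move=> top top' fS; have ltp := ltn_trans ltpq ltq.
have aE w := acceptsE w xy; have aE' w := acceptsE w xy'.
have acc_off y0 r w : acc_at y0 r w -> off u v w by case/and3P.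
split; first by split; exact: vertex_gain_ge0.
- move=> cy cy'; apply: together_gain.
  have hy w : acc_at y p w -> x y' < x w.
    move=> acc; rewrite xy' (x_off (acc_off _ _ _ acc)).
    case: (stateP_level p top) => [[m [accm minm] Em]|[/(_ w)]]; last by rewrite acc.
    by apply: leq_trans (minm _ acc); rewrite -lt_lev // cy.
  have hy' w : acc_at y' q w -> x y < x w.
    move=> acc; rewrite xy (x_off (acc_off _ _ _ acc)).
    case: (stateP_level q top') => [[m [accm minm] Em]|[/(_ w)]]; last by rewrite acc.
    by apply: leq_trans (minm _ acc); rewrite -lt_lev // cy'.
  case/orP: yy' => /eqP[yE yE']; subst.
    by apply: (matched_together e_sym x_inj neq_uv st st0 euv) => w; rewrite ?aE ?aE'; auto.
  apply: (canLR (f := mu) (g := mu)); first by case: st.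
  by apply/esym/(matched_together e_sym x_inj neq_uv st st0 euv) => w; rewrite ?aE ?aE'; auto.
- move=> m Em; case: (stateP_level p top) => [[m0 [acc0 _] E0]|[_ E0]]; last by rewrite E0 in Em.
  have {Em}-> : m = lev z (k m0) by apply: Some_inj; rewrite -Em E0.
  have [N le] := low_gets_accepted e_sym x_inj neq_uv st st0 yy' lt_yy' (w := m0) ltac:(by rewrite aE).
  exact: gain_le_vertex (acc_off _ _ _ acc0) N le.
move=> m' Em'.
case: (stateP_level q top') => [[m1 [acc1 min1] E1]|[_ E1]]; last by rewrite E1 in Em'.
have {Em'}-> : m' = lev z (k m1) by apply: Some_inj; rewrite -Em' E1.
have [|hurt] := boolP ((mu y' != y') && (x (mu y') <= x m1)).
  by case/andP=> N le; left; exact: gain_le_vertex (acc_off _ _ _ acc1) N le.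
right; rewrite negb_and negbK -ltnNge in hurt.
have a1 : accepts e x mu0 u v y' m1 by rewrite aE'.
have [acc le cause] := high_hurt_cause e_sym x_inj neq_uv st st0 yy' lt_yy' a1 hurt.
rewrite aE in acc.
case: (stateP_level p top) => [[m0 [acc0 min0] E0]|[/(_ (mu y))]]; last by rewrite acc.
split.
- exists (lev z (k m0)); [exact: E0|apply: lev_mono => //].
  apply: leq_trans (min0 _ acc) _.
  by rewrite -(x_off (acc_off _ _ _ acc)) -(x_off (acc_off _ _ _ acc1)).
(* The last choice [c'] is a second accepted neighbour, so [high_gets_backup] bounds the loss by its
   level. *)
- clear E0 E1; case: (stateP y' c' q) => // m2 acc2 min2 N2 _.
  have accc := top' _ _ acc2.
  have a2 : accepts e x mu0 u v y' m2 by rewrite aE'.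
  have ac : accepts e x mu0 u v y' c' by rewrite aE'.
  have le2c : x m2 <= x c' by rewrite (x_off (acc_off _ _ _ acc2)) (x_off (acc_off _ _ _ accc)) min2.
  have [N2' le2] := high_gets_backup e_sym x_inj neq_uv st st0 yy' lt_yy' a2 ac N2 le2c.
  exact: gain_le_vertex (acc_off _ _ _ accc) N2' le2.
(* Here [mu y = c] and the lost neighbour is [c']. As they differ, the [mu0] partner of [c] is
   ranked before position [q], so at [q] the vertex [y] does not accept even its last choice. *)
clear E0 E1; case: (stateP y c p) => // accc minc _; case: (stateP y' c' q) => // accc' minc' _ /fS Ncc'.
have muy : mu y = c.
  have [_ le0] := low_gets_accepted e_sym x_inj neq_uv st st0 yy' lt_yy' (w := c) ltac:(by rewrite aE).
  apply: x_inj; apply/eqP; rewrite eqn_leq le0 /=.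
  by rewrite (x_off (acc_off _ _ _ accc)) (x_off (acc_off _ _ _ acc)); apply: minc.
have m1c' : m1 = c'.
  apply: x_inj; apply/eqP; rewrite eqn_leq (x_off (acc_off _ _ _ acc1)) (x_off (acc_off _ _ _ accc')).
  by rewrite min1 // minc'.
case: cause => [E|[N0 lt0]]; first by rewrite -muy E m1c' eqxx in Ncc'.
have Nacc w : ~~ acc_at y q w.
  apply/negP => /top /and3P[_ _]; rewrite muy in N0 lt0.
  have oc : off u v (mu0 c) by case: st0 => _ /(_ c N0)/and3P[].
  by rewrite (negPf N0) ltnNge -xy' -(x_off oc) (ltnW lt0).
by case: (stateP y c q) => // [acc2|m2 acc2]; [have := Nacc c|have := Nacc m2]; rewrite acc2.
Qed.
End Cell.

Definition place (p q : nat) (w : V) : nat := if w == u then z p else if w == v then z q else k w.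

Hypothesis k_inj : {in off u v &, injective k}.
Hypothesis k_z : forall w p, off u v w -> p < npos -> k w != z p.

Lemma place_off p q w : off u v w -> place p q w = k w.
Proof. by case/andP => /negPf wu /negPf wv; rewrite /place wu wv. Qed.

Lemma place_inj p q : p != q -> p < npos -> q < npos -> injective (place p q).
Proof.
move=> Npq ltp ltq.
have Nz : z p != z q.
  by case: (ltngtP p q) Npq => // lt _; rewrite neq_ltn (z_mono lt) ?orbT.
have vu : (v == u) = false by rewrite eq_sym (negPf neq_uv).
have pu : place p q u = z p by rewrite /place eqxx.
have pv : place p q v = z q by rewrite /place vu eqxx.
have cases w : [\/ w = u, w = v | off u v w].
  by rewrite /off; case: (eqVneq w u) => [->|_]; [apply: Or31|case: (eqVneq w v) => [->|_]; [apply: Or32|apply: Or33]].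
move=> w w'; case: (cases w) => [->|->|ow]; case: (cases w') => [->|->|ow'] //;
  rewrite ?pu ?pv ?place_off // => E.
- by rewrite E eqxx in Nz.
- by have := k_z ow' ltp; rewrite -E eqxx.
- by rewrite E eqxx in Nz.
- by have := k_z ow' ltq; rewrite -E eqxx.
- by have := k_z ow ltp; rewrite E eqxx.
- by have := k_z ow ltq; rewrite E eqxx.
- exact: k_inj.
Qed.

Hypothesis st0 : stable (rel_off e u v) k mu0.

Lemma place_stable0 p q : stable (rel_off e u v) (place p q) mu0.
Proof.
case: st0 => mu0K edge0 stab0; split=> // a b eab.
have /and3P[_ oa ob] := eab; rewrite (place_off _ _ oa) (place_off _ _ ob).
have := stab0 a b eab; case: (eqVneq (mu0 a) a) => [_|Na]; case: (eqVneq (mu0 b) b) => [_|Nb] //=.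
- by rewrite place_off //; case/and3P: (edge0 b Nb).
- by rewrite place_off //; case/and3P: (edge0 a Na).
- have /and3P[_ _ oma] := edge0 a Na; have /and3P[_ _ omb] := edge0 b Nb.
  by rewrite !place_off.
Qed.

Variable mu : nat -> nat -> V -> V.
Hypothesis mu_st : forall p q, p != q -> p < npos -> q < npos -> stable e (place p q) (mu p q).

(** The last choices [c], [c'] and the order of their levels select the regimes; the verified bounds
    then apply through [game_sum]. *)
Lemma pair_bound : (target <= \sum_(p <- iota 0 npos) \sum_(q <- iota 0 npos | odd (q + p))
  (vertex_gain bk (place p q) (mu p q) u + vertex_gain bk (place p q) (mu p q) v))%R.
Proof.
have [c top] := last_choice u; have [c' top'] := last_choice v.
have puv : pair_uv u v u v by rewrite /pair_uv eqxx.
have pvu : pair_uv u v v u by rewrite /pair_uv eqxx orbT.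
have pu p q : place p q u = z p by rewrite /place eqxx.
have pv p q : place p q v = z q by rewrite /place eq_sym (negPf neq_uv) eqxx.
set a := lev z (k c); set b := lev z (k c').
have lea : a <= npos by apply: lev_le.
have leb : b <= npos by apply: lev_le.
pose gu p q := vertex_gain bk (place p q) (mu p q) u.
pose gv p q := vertex_gain bk (place p q) (mu p q) v.
have u_low f : (f <> Same -> c != c') -> forall x y, x < y -> y < npos -> odd (y + x) ->
    cell_ok f a b x y (state_at u c x) (state_at v c' y) (state_at u c y) (gu x y) (gv x y).
  move=> fS x y ltxy lty _; have ltx := ltn_trans ltxy lty.
  have Nxy : x != y by rewrite neq_ltn ltxy.
  exact: (cell_okP puv ltxy lty (pu x y) (pv x y) (place_off x y) (place_inj Nxy ltx lty)
    (mu_st Nxy ltx lty) (place_stable0 x y)).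
have v_low f : (f <> Same -> c' != c) -> forall x y, x < y -> y < npos -> odd (y + x) ->
    cell_ok f b a x y (state_at v c' x) (state_at u c y) (state_at v c' y) (gv y x) (gu y x).
  move=> fS x y ltxy lty _; have ltx := ltn_trans ltxy lty.
  have Nyx : y != x by rewrite neq_ltn ltxy orbT.
  exact: (cell_okP pvu ltxy lty (pv y x) (pu y x) (place_off y x) (place_inj Nyx lty ltx)
    (mu_st Nyx lty ltx) (place_stable0 y x)).
have su_le p m : state_at u c p = Backed m -> m <= a by apply: state_le.
have sv_le p m : state_at v c' p = Backed m -> m <= b by apply: state_le.
have game f f' hb ha h h' := @game_sum f f' a b (state_at u c) (state_at v c') gu gv hb ha
  lea leb su_le sv_le (u_low f h) (v_low f' h').
suff : (target <= \sum_(p <- iota 0 npos) \sum_(q <- iota 0 npos | odd (q + p)) (gu p q + gv p q))%R.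
  exact: id.
clearbody gu gv.
have [cc'|Ncc'] := eqVneq c c'.
  have ab : a = b by rewrite /a /b cc'.
  have h1 : Same = Above -> b < a by discriminate.
  have h2 : Same = Above -> a < b by discriminate.
  have h3 : Same <> Same -> c != c' by case.
  have h4 : Same <> Same -> c' != c by case.
  apply: (le_trans _ (game Same Same h1 h2 h3 h4)).
  by rewrite -ab; apply: same_bound.
have Nc'c : c' != c by rewrite eq_sym.
have [leab|ltba] := leqP a b.
  pose fa := if a == b then Below else Above.
  have h1 : Below = Above -> b < a by discriminate.
  have h2 : fa = Above -> a < b.
    rewrite /fa; case: (eqVneq a b) => [_ H|Nab _]; first discriminate H.
    by rewrite ltn_neqAle Nab leab.
  apply: (le_trans _ (game Below fa h1 h2 (fun=> Ncc') (fun=> Nc'c))).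
  have abn : a <= b <= npos by apply/andP; split; [exact: leab|exact: leb].
  exact: (differ_bound abn).
have h2 : Below = Above -> a < b by discriminate.
apply: (le_trans _ (game Above Below (fun=> ltba) h2 (fun=> Ncc') (fun=> Nc'c))).
have ban : b <= a <= npos by apply/andP; split; [exact: ltnW|exact: lea].
have := differ_bound ban; cbv zeta; rewrite (ltn_eqF ltba) => H; rewrite addrC in H; exact: H.
Qed.

End Semantics.

Local Open Scope ring_scope.

(** * Averaging over ranks on a grid *)

Definition nbuckets := 18%N.
Local Notation n := nbuckets.

Lemma sum_double (m : nat) (W : nat -> Z) :
  \sum_(p <- iota 0 m.*2) W p = \sum_(a < m) (W a.*2 + W a.*2.+1).
Proof.
elim: m => [|m IH]; first by rewrite big_nil big_ord0.
rewrite big_ord_recr -IH doubleS -addn2 iotaD big_cat add0n /=.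
by rewrite big_cons big_seq1.
Qed.

Lemma opposite_parity_sum (m : nat) (W : nat -> nat -> Z) :
  \sum_(p <- iota 0 m.*2) \sum_(q <- iota 0 m.*2 | odd (q + p)) W p q
  = \sum_(a < m) \sum_(b < m) (W a.*2 b.*2.+1 + W a.*2.+1 b.*2).
Proof.
rewrite sum_double; apply: eq_bigr => a _.
rewrite big_mkcond [X in _ + X]big_mkcond !sum_double -big_split.
apply: eq_bigr => b _; rewrite /= !oddD /= !odd_double /=.
by rewrite !(addr0, add0r).
Qed.

Section Average.
Variables (R : realType) (V : finType) (e : rel V).
Hypotheses (e_sym : symmetric e) (e_irr : irreflexive e).
Variables (L : nat) (M : (V -> nat) -> V -> V).
Hypothesis M_stable : forall k, injective k -> stable e k (M k).

(** Bucket and residue of a rank are kept apart: injective residues make the ranks injective for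
    every choice of buckets. *)
Definition rank_of (i : {ffun V -> 'I_n}) (r : {ffun V -> 'I_L}) (w : V) : nat := (i w * L + r w)%N.

Lemma rank_of_div i r w : (rank_of i r w %/ L = i w)%N.
Proof.
have L0 : (0 < L)%N by case: L (r w) => [[]|].
by rewrite /rank_of divnMDl // divn_small ?addn0.
Qed.

Lemma rank_of_mod i r w : (rank_of i r w %% L = r w)%N.
Proof. by rewrite /rank_of modnMDl modn_small. Qed.

Lemma rank_of_inj i (r : {ffun V -> 'I_L}) : injective r -> injective (rank_of i r).
Proof.
by move=> rI w w' E; apply/rI/val_inj; rewrite /= -!(rank_of_mod i) E.
Qed.

Definition edge_gain (u v : V) (k : V -> nat) : Z :=
  vertex_gain (fun t => t %/ L)%N k (M k) u + vertex_gain (fun t => t %/ L)%N k (M k) v.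

Definition override (i : {ffun V -> 'I_n}) (u v : V) (a b : 'I_n) : {ffun V -> 'I_n} :=
  [ffun w => if w == u then a else if w == v then b else i w].
Definition swap_ranks (u v : V) (r : {ffun V -> 'I_L}) : {ffun V -> 'I_L} :=
  [ffun w => r (tperm u v w)].

(* The positions of opposite parity are those reached by choosing the buckets of
   [u] and [v] and possibly exchanging their residues. *)
Lemma position_bound (u v : V) i (r : {ffun V -> 'I_L}) : u != v -> e u v -> injective r ->
  (r u < r v)%N ->
  target <= \sum_(a < n) \sum_(b < n)
    (edge_gain u v (rank_of (override i u v a b) r)
     + edge_gain u v (rank_of (override i u v a b) (swap_ranks u v r))).
Proof.
move=> Nuv euv rI ltr; have L0 : (0 < L)%N by case: L (r u) => [[]|].
have vu : (v == u) = false by rewrite eq_sym (negPf Nuv).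
(* In each bucket the even position has the smaller residue [r u], the odd one [r v]. *)
pose z p := (p./2 * L + (if odd p then r v else r u))%N.
have z_lt p : ((if odd p then r v else r u) < L)%N by case: ifP.
have z_div p : (z p %/ L)%N = p./2 by rewrite /z divnMDl // divn_small ?addn0.
have z_mod p : (z p %% L)%N = (if odd p then r v else r u) by rewrite /z modnMDl modn_small.
have z_mono p q : (p < q)%N -> (q < npos)%N -> (z p < z q)%N.
  move=> ltpq _; have [lt2|le2] := ltnP p./2 q./2.
    rewrite /z; apply: (@leq_trans (p./2.+1 * L)); first by rewrite mulSn addnC ltn_add2r.
    by rewrite (leq_trans _ (leq_addr _ _)) // leq_mul2r lt2 orbT.
  have [E [op oq]] : p./2 = q./2 /\ odd p = false /\ odd q = true by move: ltpq le2; clear; lia.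
  by rewrite /z E op oq ltn_add2l.
have bk_mono s t : (s <= t)%N -> (s %/ L <= t %/ L)%N by exact: leq_div2r.
have bk_z p : (p < npos)%N -> (z p %/ L)%N = p./2 by [].
pose k := rank_of i r.
have k_bk w : ((k w %/ L).*2 <= npos)%N.
  by rewrite rank_of_div -[npos]/(n.*2)%N leq_double ltnW.
have k_inj : {in off u v &, injective k} by move=> w w' _ _; apply: rank_of_inj.
have k_z w p : off u v w -> (p < npos)%N -> k w != z p.
  move=> /andP[wu wv] _; apply: contraNneq wu => E.
  have := congr1 (modn^~ L) E; rewrite /= rank_of_mod z_mod.
  by case: (odd p) => /val_inj/rI wE; rewrite wE eqxx ?(negPf Nuv) // in wv *.
have off_sym : symmetric (rel_off e u v).
  by move=> p q; rewrite /rel_off e_sym; congr (_ && _); apply: andbC.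
have off_irr : irreflexive (rel_off e u v) by move=> p; rewrite /rel_off e_irr.
have [||mu0 st0 _] := @ranking_stable _ _ off_sym off_irr R (fun w => (k w)%:R) k.
- exact: rank_of_inj.
- by move=> p q; rewrite ler_nat.
have := pair_bound e_sym Nuv euv z_mono bk_mono bk_z k_bk k_inj k_z st0
  (mu := fun p q => M (place u v k z p q)).
have place_lt p q : p != q -> (p < npos)%N -> (q < npos)%N -> stable e (place u v k z p q) (M (place u v k z p q)).
  by move=> Npq ltp ltq; apply/M_stable/(place_inj Nuv z_mono k_inj k_z).
move=> /(_ place_lt); rewrite -[npos]/(n.*2) opposite_parity_sum.
suff E (a b : 'I_n) : place u v k z a.*2 b.*2.+1 = rank_of (override i u v a b) r /\
   place u v k z a.*2.+1 b.*2 = rank_of (override i u v a b) (swap_ranks u v r).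
  under eq_bigr do under eq_bigr do rewrite (E _ _).1 (E _ _).2.
  exact.
split; apply/funext => w; rewrite /place /rank_of /override !ffunE /z /=.
  case: (eqVneq w u) => [->|wu]; first by rewrite odd_double doubleK.
  case: (eqVneq w v) => [->|wv]; first by rewrite odd_double /= uphalf_double.
  by [].
case: (eqVneq w u) => [->|wu]; first by rewrite odd_double /= uphalf_double tpermL.
case: (eqVneq w v) => [->|wv]; first by rewrite odd_double doubleK tpermR.
by rewrite tpermD // eq_sym.
Qed.

Lemma swap_ranksK u v : involutive (swap_ranks u v).
Proof. by move=> r; apply/ffunP => w; rewrite !ffunE tpermK. Qed.

Lemma swap_ranks_inj u v (r : {ffun V -> 'I_L}) : injective r -> injective (swap_ranks u v r).
Proof. by move=> rI w w'; rewrite !ffunE => /rI/perm_inj. Qed.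

(** Swapping the residues of [u] and [v] and shifting their buckets permute the rank vectors, so the
    full sum is an average of the sums in [position_bound]. *)
Lemma edge_average (u v : V) : u != v -> e u v ->
  target *+ #|{ffun V -> 'I_n}| *+ #|[pred r : {ffun V -> 'I_L} | injectiveb r]|
  <= (\sum_(r : {ffun V -> 'I_L} | injectiveb r) \sum_i edge_gain u v (rank_of i r))
     *+ (2 * (n * n)).
Proof.
move=> Nuv euv; pose h i r := edge_gain u v (rank_of i r).
pose H i r := h i r + h i (swap_ranks u v r).
have -> : (\sum_(r : {ffun V -> 'I_L} | injectiveb r) \sum_i h i r) *+ (2 * (n * n))
    = \sum_(r : {ffun V -> 'I_L} | injectiveb r) \sum_i \sum_(a < n) \sum_(b < n) H (override i u v a b) r.
  rewrite mulrnA [X in X *+ (n * n)](_ : _ = \sum_(r : {ffun V -> 'I_L} | injectiveb r) \sum_i H i r); last first.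
    under [RHS]eq_bigr do rewrite big_split.
    rewrite big_split /= mulr2n; congr (_ + _).
    rewrite (reindex_inj (inv_inj (swap_ranksK u v))); apply: eq_bigl => r.
    apply/injectiveP/injectiveP => rI; last exact: swap_ranks_inj.
    by rewrite -(swap_ranksK u v r); apply: swap_ranks_inj.
  rewrite -sumrMnl; apply: eq_bigr => r _.
  (* Buckets are added in the cyclic group ['I_n], so translation is a bijection on the vectors
     [i]. *)
  have shift (a b : 'I_n) : \sum_i H i r = \sum_i H (override i u v (i u + a) (i v + b)) r.
    rewrite (reindex_inj (addIr ([ffun w => if w == u then a else if w == v then b else 0] : {ffun V -> 'I_n}))).
    apply: eq_bigr => i _; congr H; apply/ffunP => w; rewrite !ffunE.
    by case: eqP => [->|_] //; case: eqP => [->|_] //; rewrite addr0.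
  transitivity (\sum_(a < n) \sum_(b < n) \sum_i H i r).
    by rewrite !sumr_const !card_ord -mulrnA.
  under eq_bigr => a _ do under eq_bigr => b _ do rewrite (shift a b).
  under eq_bigr do rewrite exchange_big.
  rewrite exchange_big; apply: eq_bigr => i _.
  rewrite [RHS](reindex_inj (addrI (i u))); apply: eq_bigr => a _.
  by rewrite [RHS](reindex_inj (addrI (i v))).
rewrite -[leLHS]sumr_const; apply: ler_sum => r /injectiveP rI.
rewrite -sumr_const; apply: ler_sum => i _.
have [lt|gt|E] := ltngtP (r u) (r v); last by rewrite (rI _ _ (val_inj E)) eqxx in Nuv.
  exact: position_bound.
have su : swap_ranks u v r u = r v by rewrite ffunE tpermL.
have sv : swap_ranks u v r v = r u by rewrite ffunE tpermR.
have := @position_bound u v i (swap_ranks u v r) Nuv euv (swap_ranks_inj rI).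
rewrite su sv => /(_ gt) /le_trans; apply; apply: ler_sum => a _; apply: ler_sum => b _.
by rewrite swap_ranksK addrC.
Qed.

End Average.

Lemma vertex_gain_pair (V : finType) bk (k : V -> nat) (mu : V -> V) w :
  injective k -> involutive mu ->
  vertex_gain bk k mu w + vertex_gain bk k mu (mu w) = if mu w != w then one else 0.
Proof.
move=> k_inj muK; rewrite /vertex_gain muK (eq_sym w).
have [//|N] := eqVneq (mu w) w.
have [lt|lt|/k_inj E] := ltngtP (k w) (k (mu w)); [by rewrite addrC subrK|by rewrite subrK|].
by rewrite -E eqxx in N.
Qed.

Lemma vertex_gain_sum (V : finType) bk (k : V -> nat) (mu : V -> V) :
  injective k -> involutive mu ->
  (\sum_w vertex_gain bk k mu w) *+ 2 = one *+ #|[set w | mu w != w]|.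
Proof.
move=> k_inj muK; rewrite mulr2n {2}(reindex_inj (inv_inj muK)) -big_split /=.
under eq_bigr do rewrite vertex_gain_pair //.
by rewrite -big_mkcond sumr_const; congr (_ *+ _); apply: eq_card => w; rewrite inE.
Qed.

Lemma matching_gain (V : finType) (e : rel V) (g : V -> Z) (Mx : {set {set V}}) :
  is_matching e Mx -> (forall w, 0 <= g w) ->
  \sum_(A in Mx) \sum_(w in A) g w <= \sum_w g w.
Proof.
case/andP=> _ tI g0; rewrite -(finset.big_trivIset _ tI) /=.
by rewrite [leRHS](bigID (mem (finset.cover Mx))) /= lerDl sumr_ge0.
Qed.

(** [72576 / (200 * 648) = 14 / 25], where [648 = 2 * 18 ^ 2]. *)
Lemma target_ratio (a s : nat) :
  target *+ a <= one *+ (s * (2 * (n * n))) -> (14 * a <= 25 * s)%N.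
Proof.
have mulZ (z : Z) m : z *+ m = Z.mul z (Z.of_nat m).
  elim: m => [|m IH]; first by rewrite mulr0n Z.mul_0_r.
  by rewrite mulrS IH Nat2Z.inj_succ Z.mul_succ_r Z.add_comm.
rewrite !mulZ Nat2Z.inj_mul /target /one.
have -> : Z.of_nat (2 * (n * n)) = Zpos 648 by [].
lia.
Qed.

Section FiniteBound.
Variables (R : realType) (V : finType) (e : rel V).
Hypotheses (e_sym : symmetric e) (e_irr : irreflexive e).

(** [edge_average] is summed over the disjoint edges of [Mx]; the shares of all vertices add up to
    the size of the output. *)
Lemma finite_bound (L : nat) (Mx : {set {set V}}) : is_matching e Mx ->
  (14 * (#|Mx| * #|{ffun V -> 'I_n}| * #|[pred r : {ffun V -> 'I_L} | injectiveb r]|)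
   <= 25 * \sum_(r : {ffun V -> 'I_L} | injectiveb r) \sum_i
        #|ranking e (fun w => (rank_of i r w)%:R : R)|)%N.
Proof.
move=> mMx.
have [M MP] : exists M, forall k : V -> nat, injective k -> stable e k (M k) /\
    #|[set p | M k p != p]| = #|ranking e (fun w => (k w)%:R : R)|.*2.
  suff /choice[M MP] : forall k : V -> nat, exists mu, injective k -> stable e k mu /\
      #|[set p | mu p != p]| = #|ranking e (fun w => (k w)%:R : R)|.*2 by exists M.
  move=> k.
  have [k_inj|N] := pselect (injective k); last by exists id.
  have [|mu st E] := @ranking_stable _ _ e_sym e_irr R (fun w => (k w)%:R) k k_inj.
    by move=> p q; rewrite ler_nat.
  by exists mu.
pose g i (r : {ffun V -> 'I_L}) := vertex_gain (fun t => t %/ L)%N (rank_of i r) (M (rank_of i r)).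
have g0 i r w : 0 <= g i r w.
  rewrite /g /vertex_gain; case: ifP => // _; case: ifP => _; first exact: psi_ge0.
  by have := psi_half (rank_of i r w %/ L).*2; have := psi_ge0 (rank_of i r w %/ L).*2; lia.
have sum_g i (r : {ffun V -> 'I_L}) : injective r ->
    \sum_w g i r w = one *+ #|ranking e (fun w => (rank_of i r w)%:R : R)|.
  move=> rI; have kI := rank_of_inj (i := i) rI; have [[muK _ _] E] := MP _ kI.
  have := vertex_gain_sum (fun t => t %/ L)%N kI muK; rewrite E -muln2 mulrnA -/(g i r).
  by move/eqP; rewrite eqrMn2r // => /eqP.
have edgeE A : A \in Mx -> target *+ #|{ffun V -> 'I_n}| *+ #|[pred r : {ffun V -> 'I_L} | injectiveb r]|
   <= (\sum_(r : {ffun V -> 'I_L} | injectiveb r) \sum_i \sum_(w in A) g i r w) *+ (2 * (n * n)).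
  move=> AM; have /andP[/forallP/(_ A) + _] := mMx; rewrite AM.
  case/existsP=> u /existsP[v /andP[euv /eqP->]].
  have Nuv : u != v by apply: contraTneq euv => ->; rewrite e_irr.
  have Mst k : injective k -> stable e k (M k) by move=> /MP[].
  refine (le_trans (edge_average R e_sym e_irr L Mst Nuv euv) _).
  rewrite lerMn2r; apply/orP; right; apply: ler_sum => r _; apply: ler_sum => i _.
  by rewrite finset.big_setU1 ?inE // finset.big_set1.
have : target *+ #|{ffun V -> 'I_n}| *+ #|[pred r : {ffun V -> 'I_L} | injectiveb r]| *+ #|Mx|
   <= (\sum_(r : {ffun V -> 'I_L} | injectiveb r) \sum_i
        one *+ #|ranking e (fun w => (rank_of i r w)%:R : R)|) *+ (2 * (n * n)).
  rewrite -[leLHS]sumr_const; refine (le_trans (ler_sum _ edgeE) _).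
  rewrite sumrMnl lerMn2r; apply/orP; right.
  rewrite exchange_big; apply: ler_sum => r /injectiveP rI.
  rewrite exchange_big; apply: ler_sum => i _; rewrite -sum_g //.
  exact: (matching_gain mMx (g0 i r)).
have -> : \sum_(r : {ffun V -> 'I_L} | injectiveb r) \sum_i
    one *+ #|ranking e (fun w => (rank_of i r w)%:R : R)|
  = one *+ \sum_(r : {ffun V -> 'I_L} | injectiveb r) \sum_i
        #|ranking e (fun w => (rank_of i r w)%:R : R)|.
  by rewrite -sumrMnr; apply: eq_bigr => r _; rewrite -sumrMnr.
set S := (\sum_(r : {ffun V -> 'I_L} | _) \sum_i _)%N.
move: (#|{ffun V -> 'I_n}|) (#|[pred r : {ffun V -> 'I_L} | injectiveb r]|) (#|Mx|) S => a b c S.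
have -> : (c * a * b = a * (b * c))%N by rewrite -mulnA mulnC -mulnA.
by rewrite -!mulrnA => /target_ratio.
Qed.
End FiniteBound.

(** * From grid cells to the expectation over uniform ranks *)

Section Expectation.
Local Open Scope classical_set_scope.
Local Open Scope ring_scope.

Section Grid.
Variable R : realType.

(** Both integrals are suprema over simple functions below the integrand. This gives lower bounds on
    the expected output size without a proof that the size is measurable. *)
Lemma ge0_integral_mono d (T : measurableType d) (mu : measure T R) (f g : T -> \bar R) :
  (forall t, 0 <= f t)%E -> (forall t, f t <= g t)%E -> (\int[mu]_t f t <= \int[mu]_t g t)%E.
Proof.
move=> f0 fg; rewrite !ge0_integralTE //; last by move=> t; apply: le_trans (fg t).
apply: le_ereal_sup => _ [h hf <-]; exists h => // t; exact: le_trans (fg t).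
Qed.

Definition grid_cell (K k : nat) : set R := [set` `[k%:R / K%:R, k.+1%:R / K%:R[].

Lemma unif01_grid_cell (K k : nat) : (k < K)%N -> unif01 R (grid_cell K k) = (K%:R^-1)%:E.
Proof.
move=> ltk; have K0 : (0 < K%:R :> R) by rewrite ltr0n (leq_ltn_trans _ ltk).
rewrite /unif01 /= /uniform_prob (eq_integral (cst 1%E)); last first.
  move=> t; rewrite inE /grid_cell /= in_itv /= => /andP[le lt]; rewrite /uniform_pdf.
  rewrite subr0 invr1 (le_trans _ le) ?divr_ge0 ?ler0n //= ifT // ltW //.
  by rewrite (lt_le_trans lt) // ler_pdivrMr // mul1r ler_nat.
rewrite integral_cst; last exact: measurable_itv.
rewrite mul1e [LHS]lebesgue_measure_itv /= lte_fin ltr_pM2r ?invr_gt0 // ltr_nat ltnSn.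
by rewrite -EFinB -mulrBl -natr1 addrAC subrr add0r mul1r.
Qed.

Variable V : finType.

Definition grid_box (K : nat) (k : V -> nat) : set (#|V|.-tuple (measurableTypeR R)) :=
  [set t | forall j, grid_cell K (k (enum_val j)) (tnth t j)].

Lemma measurable_grid_box K k : measurable (grid_box K k).
Proof.
rewrite (_ : grid_box K k = \bigcap_(j in [set: 'I_#|V|])
    ((fun t : #|V|.-tuple (measurableTypeR R) => tnth t j) @^-1` grid_cell K (k (enum_val j)))).
  apply: fin_bigcap_measurable; first exact: finite_finset.
  move=> j _; rewrite -[X in measurable X]setTI; apply: measurable_tnth => //.
  exact: measurable_itv.
by apply/seteqP; split=> t /= tk j; [move=> _|]; exact: tk.
Qed.

Lemma prob_grid_box K k : (forall v, k v < K)%N ->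
  unif_ranks R #|V| (grid_box K k) = ((K%:R^-1) ^+ #|V|)%:E.
Proof.
move=> ltk.
have -> := @unif_ranks_box R _ (fun j => grid_cell K (k (enum_val j))) (fun=> measurable_itv _).
under eq_bigr do rewrite unif01_grid_cell //.
by rewrite prodEFin prodr_const card_ord.
Qed.

Lemma grid_box_le K k (t : #|V|.-tuple (measurableTypeR R)) u v : injective k -> grid_box K k t ->
  (tnth t (enum_rank u) <= tnth t (enum_rank v)) = (k u <= k v)%N.
Proof.
move=> kI tk.
have lt a b : (k a < k b)%N -> tnth t (enum_rank a) < tnth t (enum_rank b).
  have := tk (enum_rank b); have := tk (enum_rank a); rewrite !enum_rankK /grid_cell /= !in_itv /=.
  move=> /andP[_ lta] /andP[leb _] ltk; apply: (lt_le_trans lta); apply: le_trans leb.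
  by rewrite ler_wpM2r ?invr_ge0 ?ler0n // ler_nat.
have [/lt/ltW->//|/lt|/kI->] := ltngtP (k u) (k v); last by rewrite lexx.
by rewrite leNgt => ->.
Qed.

Lemma grid_box_disj K k k' (t : #|V|.-tuple (measurableTypeR R)) : (0 < K)%N ->
  grid_box K k t -> grid_box K k' t -> k =1 k'.
Proof.
move=> K0 tk tk' v; have := tk (enum_rank v); have := tk' (enum_rank v).
rewrite !enum_rankK /grid_cell /= !in_itv /= => /andP[le1 lt1] /andP[le2 lt2].
have K0' : (0 < K%:R^-1 :> R) by rewrite invr_gt0 ltr0n.
have le_of (a b : nat) (x : R) : a%:R / K%:R <= x -> x < b.+1%:R / K%:R -> (a <= b)%N.
  by move=> le lt; have := le_lt_trans le lt; rewrite ltr_pM2r // ltr_nat ltnS.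
by apply/eqP; rewrite eqn_leq (le_of _ _ _ le2 lt1) (le_of _ _ _ le1 lt2).
Qed.

(** [f] dominates the step function equal to [F i] on the box of [k i]; these boxes are disjoint and
    have equal probability. *)
Lemma expectation_ge (I : finType) (P : pred I) (K : nat) (k : I -> V -> nat) (F : I -> nat)
   (f : #|V|.-tuple (measurableTypeR R) -> nat) : (0 < K)%N ->
  (forall i v, k i v < K)%N ->
  (forall i j, k i =1 k j -> i = j) ->
  (forall i t, P i -> grid_box K (k i) t -> f t = F i) ->
  (((\sum_(i | P i) F i)%N%:R * (K%:R^-1) ^+ #|V|)%:E <= 'E_(unif_ranks R #|V|)[fun t => (f t)%:R])%E.
Proof.
move=> K0 ltk kk fF; rewrite expectation.unlock.
set mu := unif_ranks R #|V|.
have indE i (t : #|V|.-tuple (measurableTypeR R)) : (0 <= (F i)%:R%:E * (\1_(grid_box K (k i)) t)%:E :> \bar R)%E.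
  by rewrite mule_ge0 ?lee_fin ?ler0n // indicE ler0n.
have mind i : measurable_fun [set: #|V|.-tuple (measurableTypeR R)]
    (EFin \o (\1_(grid_box K (k i)) : _ -> R)).
  by apply/measurable_EFinP; apply: measurable_indic; apply: measurable_grid_box.
have -> : ((\sum_(i | P i) F i)%N%:R * (K%:R^-1) ^+ #|V|)%:E
    = (\int[mu]_t \sum_(i <- enum P) (F i)%:R%:E * (\1_(grid_box K (k i)) t)%:E)%E.
  rewrite ge0_integral_sum //; last by move=> i; apply: measurable_funeM; apply: mind.
  rewrite natr_sum mulr_suml -sumEFin big_enum /=; apply: eq_big => // i Pi.
  rewrite ge0_integralZl_EFin ?ler0n //; last exact: mind.
  rewrite integral_indic //; last exact: measurable_grid_box.
  by rewrite setIT [X in (_ * X)%E](prob_grid_box (ltk i)).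
apply: ge0_integral_mono => t; first by apply: sume_ge0.
rewrite big_enum /=; have [[i Pi ti]|none] := pselect (exists2 i, P i & grid_box K (k i) t).
  rewrite (bigD1 i) //= big1 ?adde0.
    by rewrite indicE mem_set // mule1 (fF i).
  move=> j /andP[_ Nji]; rewrite indicE memNset ?mule0 // => tj.
  by move: Nji; rewrite (kk j i) ?eqxx //; apply: grid_box_disj tj ti.
rewrite big1 ?lee_fin ?ler0n // => i Pi; rewrite indicE memNset ?mule0 // => ti.
by apply: none; exists i.
Qed.
End Grid.

End Expectation.

(** * The limit of fine grids *)

(** At least a fraction [1 - m ^ 2 / L] of the [m]-tuples of residues is injective. *)
Lemma ffact_lower (L m : nat) : (L ^ m * (L - m ^ 2) <= L * L ^_ m)%N.
Proof.
elim: m => [|m IH]; first by rewrite expn0 mul1n subn0 ffactn0 muln1.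
have [lt|ge] := ltnP L (m.+1 ^ 2).
  have /eqP -> : (L - m.+1 ^ 2 == 0)%N by rewrite subn_eq0 ltnW.
  by rewrite muln0.
rewrite ffactnSr mulnA; apply: leq_trans (leq_mul IH (leqnn (L - m))).
rewrite expnSr -!mulnA leq_mul2l; apply/orP; right.
have lem : (m ^ 2 <= L)%N by apply: leq_trans ge; rewrite leq_exp2r.
have lem' : (m <= L)%N by apply: leq_trans ge; rewrite (leq_trans (leqnSn m)) // -{1}(expn1 m.+1) leq_pexp2l.
move: ge lem lem'; rewrite -!mulnn; nia.
Qed.

Section Ratio.
Variables (R : realType) (V : finType) (e : rel V).
Hypotheses (e_sym : symmetric e) (e_irr : irreflexive e).

Let size_ranking (t : #|V|.-tuple (measurableTypeR R)) : nat :=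
  #|ranking e (fun v => tnth t (enum_rank v))|.

(** Only grid boxes with distinct residues are kept. On each of them the order of the ranks, hence
    the output, is constant, and [finite_bound] applies. *)
Lemma expectation_grid (L : nat) (Mx : {set {set V}}) : is_matching e Mx -> (0 < L)%N ->
  ((14%:R / 25%:R * #|Mx|%:R * ((L ^_ #|V|)%:R / L%:R ^+ #|V|))%:E
    <= 'E_(unif_ranks R #|V|)[fun t => (size_ranking t)%:R])%E.
Proof.
move=> mMx L0; pose ranks := {ffun V -> 'I_L}; pose buckets := {ffun V -> 'I_nbuckets}.
pose k (c : ranks * buckets) := rank_of c.2 c.1.
have ltk c v : (k c v < nbuckets * L)%N.
  rewrite /k /rank_of (@leq_trans ((c.2 v).+1 * L)%N) //; last by rewrite leq_mul2r ltn_ord orbT.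
  by rewrite mulSn addnC ltn_add2r.
have kI (c : ranks * buckets) : injectiveb c.1 -> injective (k c).
  by move=> /injectiveP cI; apply: rank_of_inj.
have kk c c' : k c =1 k c' -> c = c'.
  case: c c' => [r i] [r' i'] E; congr (_, _); apply/ffunP => v; apply: val_inj => /=.
    by rewrite -(rank_of_mod i) -(rank_of_mod i') -/(k (r, i) v) E.
  by rewrite -(rank_of_div i r) -(rank_of_div i' r') -/(k (r, i) v) E.
have fF (c : ranks * buckets) (t : #|V|.-tuple (measurableTypeR R)) : injectiveb c.1 -> grid_box (nbuckets * L)%N (k c) t ->
    size_ranking t = #|ranking e (fun w => (k c w)%:R : R)|.
  move=> cI tc; rewrite /size_ranking; congr #|pred_of_set _|; apply: eq_ranking => u v.
  by rewrite ler_nat; apply: grid_box_le (kI _ cI) tc.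
have K0 : (0 < nbuckets * L)%N by rewrite muln_gt0.
apply: le_trans (expectation_ge K0 ltk kk fF).
have := finite_bound R e_sym e_irr L mMx.
rewrite pair_big_dep /=.
rewrite (eq_bigl (fun c : ranks * buckets => injectiveb c.1)); last by move=> c; rewrite andbT.
set S := (\sum_(c | _) _)%N => le.
have cardr : #|[pred r : ranks | injectiveb r]| = (L ^_ #|V|)%N.
  by rewrite -[in RHS](card_ord L) -card_inj_ffuns; apply: eq_card => r; rewrite !inE.
rewrite lee_fin.
have le' : 14%:R * (#|Mx|%:R * (nbuckets%:R ^+ #|V|) * (L ^_ #|V|)%:R) <= 25%:R * S%:R :> R.
  by move: le; rewrite cardr card_ffun card_ord -(ler_nat R) !natrM natrX.
have n0 : (0 < nbuckets%:R ^+ #|V| :> R) by rewrite exprn_gt0 // ltr0n.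
have l0 : (0 < L%:R ^+ #|V| :> R) by rewrite exprn_gt0 // ltr0n.
have -> : (nbuckets * L)%:R^-1 ^+ #|V| = (nbuckets%:R ^+ #|V|)^-1 / L%:R ^+ #|V| :> R.
  by rewrite natrM invfM exprMn !exprVn.
rewrite !mulrA ler_pM2r ?invr_gt0 // ler_pdivlMr //.
rewrite -(ler_pM2l (x := 25%:R)) ?ltr0n //; apply: le_trans le'.
rewrite le_eqVlt; apply/orP; left; apply/eqP.
by field.
Qed.

Lemma expectation_matching (Mx : {set {set V}}) : is_matching e Mx ->
  ((14%:R / 25%:R * #|Mx|%:R)%:E <= 'E_(unif_ranks R #|V|)[fun t => (size_ranking t)%:R])%E.
Proof.
move=> mMx; set a := (14%:R / 25%:R * #|Mx|%:R : R).
have a0 : 0 <= a by rewrite /a mulr_ge0 ?divr_ge0 ?ler0n.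
apply/lee_addgt0Pr => eps eps0.
(* For [L > b] the loss [a * #|V| ^ 2 / L] from repeated residues is at most [eps]. *)
pose b := a * (#|V| ^ 2)%:R / eps.
have b0 : 0 <= b by rewrite divr_ge0 ?mulr_ge0 ?ler0n // ltW.
have ltb := archi_boundP b0; set L := Num.bound b in ltb.
have L0 : (0 < L)%N by rewrite -(ltr_nat R) (le_lt_trans b0).
apply: le_trans (leeD2r _ (expectation_grid mMx L0)); rewrite -EFinD lee_fin -/a.
have l0 : (0 < L%:R ^+ #|V| :> R) by rewrite exprn_gt0 // ltr0n.
have L0' : (0 < L%:R :> R) by rewrite ltr0n.
have le1 : 1 - (#|V| ^ 2)%:R / L%:R <= (L ^_ #|V|)%:R / L%:R ^+ #|V| :> R.
  rewrite ler_pdivlMr // -(ler_pM2l L0') mulrA mulrBr mulr1 mulrCA divff ?gt_eqF // mulr1.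
  have [le|lt] := leqP (#|V| ^ 2) L.
    by rewrite -natrB // mulrC -natrX -!natrM ler_nat ffact_lower.
  apply: (@le_trans _ _ 0); last by rewrite mulr_ge0 // ler0n.
  by apply: mulr_le0_ge0; [rewrite subr_le0 ler_nat ltnW|exact: ltW].
have le2 : a * ((#|V| ^ 2)%:R / L%:R) <= eps.
  by rewrite mulrA ler_pdivrMr // [leRHS]mulrC -ler_pdivrMr // ltW.
have := ler_wpM2l a0 le1; rewrite mulrBr mulr1 lerBlDr => /le_trans; apply.
by rewrite lerD2l.
Qed.

End Ratio.

Theorem theorem1p1 (R : realType) :
  ((560%:R / 1000%:R : R)%:E <= approximation_ratio R)%E /\
  (forall (V : finType) (e : rel V),
     simple_graph e -> (exists u v : V, e u v) ->
     ((560%:R / 1000%:R : R)%:E <= ranking_ratio R e)%E).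
Proof.
have main (V : finType) (e : rel V) : simple_graph e -> (exists u v : V, e u v) ->
    ((560%:R / 1000%:R : R)%:E <= ranking_ratio R e)%E.
  move=> [e_sym e_irr] [u [v euv]].
  have Nuv : u != v by apply: contraTneq euv => ->; rewrite e_irr.
  (* A single edge is a matching, so the maximum is attained and the division is by a positive
     number. *)
  have m1 : is_matching e [set [set u; v]].
    apply/andP; split.
      apply/forallP => A; apply/implyP; rewrite inE => /eqP->.
      by apply/existsP; exists u; apply/existsP; exists v; rewrite euv /=.
    by apply/finset.trivIsetP => A B; rewrite !inE => /eqP-> /eqP->; rewrite eqxx.
  have [Mx mMx nuE] : exists2 Mx, is_matching e Mx & matching_number e = #|Mx|.
    have [|Mx mMx E] := @eq_bigmax_cond _ (is_matching e) (fun M => #|M|).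
      by apply/card_gt0P; exists [set [set u; v]].
    by exists Mx.
  have nu0 : (0 < #|Mx|)%N.
    rewrite -nuE; apply: (leq_trans _ (@leq_bigmax_cond _ (is_matching e) (fun M => #|M|) _ m1)).
    by rewrite cards1.
  have := expectation_matching R e_sym e_irr mMx.
  rewrite /ranking_ratio nuE; set E := ('E_ _ [_])%E => le.
  have nu0' : (0 < #|Mx|%:R :> R) by rewrite ltr0n.
  rewrite inver gt_eqF // -(@lee_pmul2r _ #|Mx|%:R%:E) ?lte_fin //.
  rewrite -[X in (_ <= X)%E]muleA -[X in (_ <= _ * X)%E]EFinM mulVf ?gt_eqF // mule1 -EFinM.
  by have -> : 560%:R / 1000%:R = 14%:R / 25%:R :> R by field.
split=> //; apply/ereal_infP => _ [V [e [simple edge ->]]]; exact: main.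
Qed.
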